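(* On $T^*(\mathbb R^\ell\times\mathbb T)$ with coordinates $(q,\phi;p,\gamma)$ consider $$H(q,\phi;p,\gamma)=\tfrac12\big(p\cdot p+2\gamma\,a(q,\phi)\cdot p+h(q,\phi)\gamma^2\big)+U(q,\phi),$$ $2\pi$-periodic in $\phi$, with $a=a_0(q)+\epsilon a_1(q,\phi)$, $h=h_0(q)+\epsilon h_1(q,\phi)$, $U=U_0(q)+\epsilon U_1(q,\phi)$, where $a_1,h_1,U_1$ have zero mean in $\phi$. Consider the system (Hamiltonian for $\omega=\frac1\epsilon dq\wedge dp+d\phi\wedge d\gamma$) $$\dot q=\epsilon(p+\gamma a),\quad \dot\phi=a\cdot p+h\gamma,\quad \dot p=-\epsilon\,\partial_q\big(\gamma a\cdot p+\tfrac12h\gamma^2+U\big),\quad \dot\gamma=-\epsilon\,\partial_\phi\big(\gamma a_1\cdot p+\tfrac12 h_1\gamma^2+U_1\big),$$ and the averaged system for $\bar H(Q,P,\mu)=\tfrac12P\cdot P+\mu\,a_0(Q)\cdot P+\tfrac12\mu^2h_0(Q)+U_0(Q)$: $$\dot Q=\epsilon(P+\mu a_0(Q)),\quad \dot P=-\epsilon\,\partial_Q\big(\mu a_0(Q)\cdot P+\tfrac12h_0(Q)\mu^2+U_0(Q)\big),\quad\dot\mu=0.$$ Assume the data are $C^3$-bounded on $D\times\mathbb T$ for a domain $D\subset\mathbb R^{2\ell+1}$ of $(q,p,\gamma)$, that the fast frequency satisfies $a\cdot p+h\gamma>C>0$ there, and that the averaged solution $(Q(t),P(t),\mu)$ stays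 in a subdomain $D_\delta$ whose $\delta$-neighbourhood lies in $D$ for $0\le t\le1/\epsilon$. Then there exist $\epsilon_0>0$ and $C_0$ independent of $\epsilon$ such that for $0<\epsilon<\epsilon_0$, solutions with equal initial data $(q(0),p(0),\gamma(0))=(Q(0),P(0),\mu)$ satisfy $|\gamma(t)-\mu|+|q(t)-Q(t)|+|p(t)-P(t)|<C_0\epsilon$ for all $0\le t\le1/\epsilon$.
   Context: Dot denotes the Euclidean inner product on $\mathbb R^\ell$ and also the time derivative; $\mathbb T=S^1=\mathbb R/2\pi\mathbb Z$. *)

(* Defs.v *)
From Stdlib Require Import Reals.
From mathcomp Require Import ssreflect ssrfun ssrbool eqtype ssrnat fintype bigop.
Set Implicit Arguments. Unset Strict Implicit.
Open Scope R_scope.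

Definition vec (l : nat) := 'I_l -> R.

Definition dot {l : nat} (u v : vec l) : R := \big[Rplus/0]_(i < l) (u i * v i).
Definition vnorm {l : nat} (u : vec l) : R := sqrt (dot u u).
Definition vsub {l : nat} (u v : vec l) : vec l := fun i => u i - v i.

Definition upd {l : nat} (x : vec l) (j : 'I_l) (s : R) : vec l :=
  fun i => if i == j then s else x i.

Definition dist_qphi {l : nat} (q : vec l) (phi : R) (q' : vec l) (phi' : R) : R :=
  sqrt (dot (vsub q q') (vsub q q') + (phi - phi') ^ 2).

Definition dist_qpg {l : nat} (q p : vec l) (g : R) (q' p' : vec l) (g' : R) : R :=
  sqrt (dot (vsub q q') (vsub q q') + dot (vsub p p') (vsub p p') + (g - g') ^ 2).

Definition cont_at {l : nat} (F : vec l -> R -> R) (q : vec l) (phi : R) : Prop :=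
  forall e, 0 < e -> exists d, 0 < d /\
    forall q' phi', dist_qphi q' phi' q phi < d -> Rabs (F q' phi' - F q phi) < e.

Fixpoint CkB {l : nat} (k : nat) (S : vec l -> R -> Prop) (M : R)
    (F : vec l -> R -> R) : Prop :=
  (forall q phi, S q phi -> Rabs (F q phi) <= M /\ cont_at F q phi) /\
  match k with
  | O => True
  | S k' =>
      (forall j : 'I_l, exists G : vec l -> R -> R,
          (forall q phi, S q phi ->
             derivable_pt_lim (fun s => F (upd q j s) phi) (q j) (G q phi)) /\
          CkB k' S M G) /\
      (exists G : vec l -> R -> R,
          (forall q phi, S q phi ->
             derivable_pt_lim (fun s => F q s) phi (G q phi)) /\
          CkB k' S M G)
  end.

Section Systems.
Context {l : nat} (a0 : vec l -> vec l) (a1 : vec l -> R -> vec l)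
  (h0 U0 : vec l -> R) (h1 U1 : vec l -> R -> R).

Definition a_eps (eps : R) (q : vec l) (phi : R) : vec l :=
  fun i => a0 q i + eps * a1 q phi i.
Definition h_eps (eps : R) (q : vec l) (phi : R) : R := h0 q + eps * h1 q phi.
Definition U_eps (eps : R) (q : vec l) (phi : R) : R := U0 q + eps * U1 q phi.

Definition Kfull (eps : R) (q : vec l) (phi : R) (p : vec l) (g : R) : R :=
  g * dot (a_eps eps q phi) p + / 2 * h_eps eps q phi * g ^ 2 + U_eps eps q phi.
Definition K1 (q : vec l) (phi : R) (p : vec l) (g : R) : R :=
  g * dot (a1 q phi) p + / 2 * h1 q phi * g ^ 2 + U1 q phi.
Definition Kavg (mu : R) (Q P : vec l) : R :=
  mu * dot (a0 Q) P + / 2 * h0 Q * mu ^ 2 + U0 Q.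

Definition FullSol (eps T : R) (q : R -> vec l) (phi : R -> R) (p : R -> vec l)
    (g : R -> R) : Prop :=
  forall t, 0 <= t <= T ->
    (forall i, derivable_pt_lim (fun s => q s i) t
                 (eps * (p t i + g t * a_eps eps (q t) (phi t) i))) /\
    derivable_pt_lim phi t
      (dot (a_eps eps (q t) (phi t)) (p t) + h_eps eps (q t) (phi t) * g t) /\
    (forall i, exists L,
        derivable_pt_lim (fun s => Kfull eps (upd (q t) i s) (phi t) (p t) (g t))
          (q t i) L /\
        derivable_pt_lim (fun s => p s i) t (- eps * L)) /\
    (exists L,
        derivable_pt_lim (fun s => K1 (q t) s (p t) (g t)) (phi t) L /\
        derivable_pt_lim g t (- eps * L)).

(* (Q, P, mu) solves the averaged system on [0, T] (mu constant, so mu' = 0) *)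
Definition AvgSol (eps T mu : R) (Q P : R -> vec l) : Prop :=
  forall t, 0 <= t <= T ->
    (forall i, derivable_pt_lim (fun s => Q s i) t
                 (eps * (P t i + mu * a0 (Q t) i))) /\
    (forall i, exists L,
        derivable_pt_lim (fun s => Kavg mu (upd (Q t) i s) (P t)) (Q t i) L /\
        derivable_pt_lim (fun s => P s i) t (- eps * L)).
End Systems.

(* Main.v *)
(* No averaging transformation is needed, because both energies are conserved:
   the full Hamiltonian along the full flow and the averaged one along the
   averaged flow, and the two differ by O(eps). The full Hamiltonian is strictly
   increasing in gamma with slope the fast frequency, which exceeds C, so
   comparing energies gives |gamma - mu| <= c (|q - Q| + |p - P| + eps). With
   this, the equations for (q, p) and (Q, P) differ by
   O(eps) (|q - Q| + |p - P| + eps), and Gronwall's inequality on [0, 1/eps]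
   yields the O(eps) bound. A continuation argument keeps the solution in the
   delta-neighbourhood, and hence in D, up to time 1/eps. *)
Require Import Defs.
From HB Require Import structures.
From Stdlib Require Import Reals Lra Psatz FunctionalExtensionality ClassicalEpsilon.
From mathcomp Require Import ssreflect ssrfun ssrbool eqtype ssrnat seq fintype bigop.
Open Scope R_scope.
Set Implicit Arguments.
Unset Strict Implicit.

(** The domain [D] need be neither convex nor bounded in [p], and this shapes the estimates. Mean
    value bounds are confined to coordinate boxes inside a delta-ball around [Q t]. The size of [P]
    is controlled by a separate Gronwall argument: the averaged force is at most linear in [P], so
    [P] stays bounded over a time [1/eps], and [p] stays within delta of it. The data come with
    partial derivatives only, so energy conservation first needs a chain rule along curves derived
    from continuity of the partials. All constants are fixed before [eps] and the solutions are
    introduced, which is what makes the final bound uniform. *)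

HB.instance Definition _ := Monoid.isComLaw.Build R 0 Rplus
  (fun x y z => esym (Rplus_assoc x y z)) Rplus_comm Rplus_0_l.

Local Notation "\rsum_ ( i < n ) F" := (\big[Rplus/0]_(i < n) F)
  (at level 41, F at level 41, i, n at level 50).
Local Notation deriv := derivable_pt_lim.

(** * Finite sums and their bounds *)

Lemma Rabs_le_bounds x b : Rabs x <= b -> - b <= x <= b.
Proof. by split_Rabs; lra. Qed.

Lemma rsum_scale (I : Type) (s : seq I) (c : R) (f : I -> R) :
  \big[Rplus/0]_(i <- s) (c * f i) = c * \big[Rplus/0]_(i <- s) f i.
Proof. by elim: s => [|i s IH]; rewrite ?big_nil ?big_cons ?IH; ring. Qed.

Lemma rsum_le (I : Type) (s : seq I) (f g : I -> R) :
  (forall i, f i <= g i) ->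
  \big[Rplus/0]_(i <- s) f i <= \big[Rplus/0]_(i <- s) g i.
Proof.
move=> H; elim: s => [|i s IH]; rewrite ?big_nil ?big_cons; first lra.
have := H i; lra.
Qed.

Lemma rsum_const (l : nat) (b : R) : \rsum_(i < l) b = INR l * b.
Proof.
elim: l => [|l IH]; first by rewrite big_ord0 /=; ring.
by rewrite big_ord_recl IH S_INR; ring.
Qed.

Lemma rsum_le_const (l : nat) (f : vec l) (b : R) :
  (forall i, f i <= b) -> \rsum_(i < l) f i <= INR l * b.
Proof. by move=> H; rewrite -rsum_const; apply: rsum_le. Qed.

Lemma Rabs_rsum_le (l : nat) (f : vec l) (b : R) :
  (forall i, Rabs (f i) <= b) -> Rabs (\rsum_(i < l) f i) <= INR l * b.
Proof.
move=> H; apply: Rabs_le; split; last first.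
  by apply: rsum_le_const => i; have /Rabs_le_bounds := H i; lra.
rewrite -Ropp_mult_distr_r_reverse -rsum_const.
by apply: rsum_le => i; have /Rabs_le_bounds := H i; lra.
Qed.

Lemma rsum_ge0 (l : nat) (f : vec l) : (forall i, 0 <= f i) -> 0 <= \rsum_(i < l) f i.
Proof. by move=> H; elim/big_ind: _ => [|x y ? ?|i _]; [lra|lra|exact: H]. Qed.

Lemma rsum_ge_term (l : nat) (f : vec l) (j : 'I_l) :
  (forall i, 0 <= f i) -> f j <= \rsum_(i < l) f i.
Proof.
move=> H; rewrite (bigD1 j) //= -[X in X <= _]Rplus_0_r; apply: Rplus_le_compat_l.
by elim/big_ind: _ => [|x y ? ?|i _]; [lra|lra|exact: H].
Qed.

Lemma dot_self_ge0 (l : nat) (u : vec l) : 0 <= dot u u.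
Proof. by apply: rsum_ge0 => i; nra. Qed.

Lemma coord_sq_le_dot (l : nat) (u : vec l) (j : 'I_l) : u j * u j <= dot u u.
Proof. by apply: (@rsum_ge_term l (fun i => u i * u i) j) => i; nra. Qed.

Lemma dot_self_le_const (l : nat) (u : vec l) (b : R) :
  (forall i, Rabs (u i) <= b) -> dot u u <= INR l * (b * b).
Proof.
move=> H; apply: rsum_le_const => i.
by have /Rabs_le_bounds := H i; nra.
Qed.

(** * Coordinate replacement and rules for derivatives *)

Lemma updK (l : nat) (x : vec l) (j : 'I_l) : upd x j (x j) = x.
Proof. by apply: functional_extensionality => i; rewrite /upd; case: eqP => [->|]. Qed.

Lemma upd_upd (l : nat) (x : vec l) (j : 'I_l) (s r : R) : upd (upd x j s) j r = upd x j r.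
Proof. by apply: functional_extensionality => i; rewrite /upd; case: eqP. Qed.

Lemma upd_same (l : nat) (x : vec l) (j : 'I_l) (s : R) : upd x j s j = s.
Proof. by rewrite /upd eqxx. Qed.

(* Pointwise forms of the Stdlib rules, stated so that they unify with explicit lambdas. *)
Lemma deriv_add f g t f' g' :
  deriv f t f' -> deriv g t g' -> deriv (fun s => f s + g s) t (f' + g').
Proof. exact: derivable_pt_lim_plus. Qed.

Lemma deriv_mul f g t f' g' :
  deriv f t f' -> deriv g t g' -> deriv (fun s => f s * g s) t (f' * g t + f t * g').
Proof. exact: derivable_pt_lim_mult. Qed.

Lemma deriv_sub f g t f' g' :
  deriv f t f' -> deriv g t g' -> deriv (fun s => f s - g s) t (f' - g').
Proof. exact: derivable_pt_lim_minus. Qed.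

Lemma deriv_cst c t : deriv (fun _ => c) t 0.
Proof. exact: derivable_pt_lim_const. Qed.

Lemma deriv_scale c f t f' : deriv f t f' -> deriv (fun s => c * f s) t (c * f').
Proof. exact: derivable_pt_lim_scal. Qed.

Lemma deriv_rsum (l : nat) (f : 'I_l -> R -> R) (t : R) (f' : vec l) :
  (forall i, deriv (f i) t (f' i)) ->
  deriv (fun s => \rsum_(i < l) f i s) t (\rsum_(i < l) f' i).
Proof.
move=> H; elim: (index_enum _) => [|i s IH].
  rewrite big_nil; have -> : (fun s => \big[Rplus/0]_(i <- [::]) f i s) = fun _ => 0.
    by apply: functional_extensionality => s; rewrite big_nil.
  exact: deriv_cst.
rewrite big_cons; have -> : (fun r => \big[Rplus/0]_(i0 <- i :: s) f i0 r)
    = fun r => f i r + \big[Rplus/0]_(i0 <- s) f i0 r.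
  by apply: functional_extensionality => r; rewrite big_cons.
exact: deriv_add.
Qed.

Lemma deriv_uniq f t a b : deriv f t a -> deriv f t b -> a = b.
Proof. exact: uniqueness_limite. Qed.

Lemma deriv_lipschitz_near f t f' : deriv f t f' ->
  exists d, 0 < d /\ forall h, Rabs h < d -> Rabs (f (t + h) - f t) <= (Rabs f' + 1) * Rabs h.
Proof.
move=> /(_ 1 Rlt_0_1) [d Hd]; exists d; split; first exact: cond_pos.
move=> h hd; case: (Req_dec h 0) => [->|h0].
  by rewrite Rplus_0_r Rminus_diag Rabs_R0; lra.
have := Hd h h0 hd => H1.
have -> : f (t + h) - f t = ((f (t + h) - f t) / h - f' + f') * h by field.
rewrite Rabs_mult; apply: Rmult_le_compat_r; first exact: Rabs_pos.
have := Rabs_triang ((f (t + h) - f t) / h - f') f'; lra.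
Qed.

(** * Mean value estimates and the chain rule *)

(** The reference slope [c] lets this and the box version serve two purposes: with [c] the
    derivative at a base point and [e] small they bound the remainder in the chain rule, with
    [c = 0] and [e] a bound on the derivative they give Lipschitz estimates. *)
Lemma mean_value_dev f f' a b c e :
  (forall s, Rmin a b <= s <= Rmax a b -> deriv f s (f' s) /\ Rabs (f' s - c) <= e) ->
  Rabs (f b - f a - c * (b - a)) <= e * Rabs (b - a).
Proof.
have up u v : u < v ->
    (forall s, u <= s <= v -> deriv f s (f' s) /\ Rabs (f' s - c) <= e) ->
    Rabs (f v - f u - c * (v - u)) <= e * Rabs (v - u).
  move=> uv H; have [s [-> hs]] := MVT_cor2 f f' u v uv (fun s h => proj1 (H s h)).
  have -> : f' s * (v - u) - c * (v - u) = (f' s - c) * (v - u) by ring.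
  rewrite Rabs_mult; apply: Rmult_le_compat_r; first exact: Rabs_pos.
  by apply: (H s _).2; lra.
case: (Rtotal_order a b) => [ab|[->|ab]] H.
- apply: up => // s hs; apply: H; rewrite Rmin_left ?Rmax_right; lra.
- by rewrite !Rminus_diag Rmult_0_r Rminus_diag Rabs_R0; lra.
- have := up b a ab; rewrite Rmin_right ?Rmax_left in H; try lra.
  move=> /(_ H); rewrite (Rabs_minus_sym b a) => H1.
  rewrite -Rabs_Ropp.
  by have -> : - (f b - f a - c * (b - a)) = f a - f b - c * (a - b) by ring.
Qed.

(* The coordinates of x are changed into those of y one at a time, so that
   only the one-variable mean value theorem is needed. *)
Lemma mean_value_box (l : nat) (F : vec l -> R) (G : 'I_l -> vec l -> R) (c x y : vec l) (e : R) :
  (forall z, (forall i, Rmin (x i) (y i) <= z i <= Rmax (x i) (y i)) ->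
     forall j, deriv (fun s => F (upd z j s)) (z j) (G j z) /\ Rabs (G j z - c j) <= e) ->
  Rabs (F y - F x - \rsum_(i < l) (c i * (y i - x i))) <= e * \rsum_(i < l) Rabs (y i - x i).
Proof.
move=> H.
(* Induction on the list [s] of coordinates still to be changed: the current point [x'] agrees with
   [x] on [s] and with [y] off it. *)
have path (s : seq 'I_l) : uniq s -> forall x',
    (forall i, i \in s -> x' i = x i) -> (forall i, i \notin s -> x' i = y i) ->
    Rabs (F y - F x' - \big[Rplus/0]_(i <- s) (c i * (y i - x i)))
      <= e * \big[Rplus/0]_(i <- s) Rabs (y i - x i).
  elim: s => [_ x' _ Hy|j s IH /= /andP [js us] x' Hx Hy].
    have -> : x' = y by apply: functional_extensionality => i; exact: Hy.
    by rewrite !big_nil !Rminus_diag Rabs_R0; lra.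
  have xj : x' j = x j by apply: Hx; rewrite inE eqxx.
  have := IH us (upd x' j (y j)); rewrite !big_cons => IH'.
  have {}IH' := IH' _ _.
  have : Rabs (F (upd x' j (y j)) - F (upd x' j (x j)) - c j * (y j - x j))
      <= e * Rabs (y j - x j).
    apply: (@mean_value_dev (fun r => F (upd x' j r)) (fun r => G j (upd x' j r)) (x j) (y j)) => r hr.
    have Hz i : Rmin (x i) (y i) <= upd x' j r i <= Rmax (x i) (y i).
      rewrite /upd; case: eqP => [->//|/eqP ij].
      case: (boolP (i \in s)) => is_.
        rewrite Hx ?inE ?is_ ?orbT //; split; [exact: Rmin_l|exact: Rmax_l].
      rewrite Hy ?inE ?negb_or ?ij //; split; [exact: Rmin_r|exact: Rmax_r].
    have := H _ Hz j; rewrite upd_same.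
    have -> // : (fun s => F (upd (upd x' j r) j s)) = fun r => F (upd x' j r).
    by apply: functional_extensionality => r'; rewrite upd_upd.
  rewrite -xj updK xj => H1.
  have H2 : Rabs (F y - F (upd x' j (y j)) - \big[Rplus/0]_(i <- s) (c i * (y i - x i)))
      <= e * \big[Rplus/0]_(i <- s) Rabs (y i - x i).
    apply: IH'.
    - move=> i is_; rewrite /upd; case: eqP => [ij|_]; first by rewrite -ij is_ in js.
      by apply: Hx; rewrite inE is_ orbT.
    - move=> i is_; rewrite /upd; case: eqP => [->//|/eqP ij].
      by apply: Hy; rewrite inE negb_or ij.
  move: H1 H2.
  set u := \big[Rplus/0]_(i <- s) (c i * _); set v := \big[Rplus/0]_(i <- s) Rabs _.
  set A := F y - F _ - u; set B := F _ - F x' - _ => H1 H2.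
  have -> : F y - F x' - (c j * (y j - x j) + u) = A + B by rewrite /A /B; ring.
  by have := Rabs_triang A B; lra.
apply: path => //; first exact: index_enum_uniq.
by move=> i; rewrite mem_index_enum.
Qed.

Lemma uniform_radius (l : nat) (P : 'I_l -> R -> Prop) :
  (forall j d d', 0 < d' <= d -> P j d -> P j d') ->
  (forall j, exists d, 0 < d /\ P j d) -> exists d, 0 < d /\ forall j, P j d.
Proof.
move=> mono H.
suff [d [d0 Hd]] : exists d, 0 < d /\ forall j, j \in enum 'I_l -> P j d.
  by exists d; split=> // j; apply: Hd; rewrite mem_enum.
elim: (enum _) => [|j s [d [d0 Hd]]]; first by exists 1; split; [lra|].
have [d' [d'0 Hd']] := H j; exists (Rmin d d'); have m0 := Rmin_pos _ _ d0 d'0; split=> // i.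
rewrite inE => /orP [/eqP ->|/Hd].
- by apply: mono Hd'; have := Rmin_r d d'; lra.
- by apply: mono; have := Rmin_l d d'; lra.
Qed.

Lemma cont_at_box (l : nat) (F : vec l -> R -> R) (q : vec l) (phi e : R) :
  cont_at F q phi -> 0 < e -> exists d, 0 < d /\ forall q' phi',
    (forall i, Rabs (q' i - q i) < d) -> Rabs (phi' - phi) < d ->
    Rabs (F q' phi' - F q phi) < e.
Proof.
move=> Hc e0; have [d [d0 Hd]] := Hc e e0.
(* With side [b = d / (l + 2)], the [l] coordinates and [phi] contribute at most [(l + 1) b^2],
   which is strictly below [(l + 2)^2 b^2 = d^2], also for [l = 0]. *)
have n0 := pos_INR l; set k := INR l + 2.
have kd : d / k * k = d by rewrite /k; field; lra.
have dk : 0 < d / k by apply: Rdiv_lt_0_compat; rewrite /k; lra.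
exists (d / k); split=> // q' phi' Hq Hphi; apply: Hd.
rewrite /dist_qphi -(sqrt_square d); last lra.
apply: sqrt_lt_1_alt; have Hu := dot_self_ge0 (vsub q' q).
have := dot_self_le_const (u := vsub q' q) (fun i => Rlt_le _ _ (Hq i)).
have [h1 h2] := Rabs_def2 _ _ Hphi.
set b := d / k in dk kd h1 h2 * => hd.
have {}kd : d * d = b * b * ((INR l + 2) * (INR l + 2)) by rewrite -kd /k; ring.
split; first by have := pow2_ge_0 (phi' - phi); lra.
have : (phi' - phi) ^ 2 <= b * b by nra.
have : 0 < b * b by nra.
by nra.
Qed.

(** Continuity of the partials at the base point makes the increment of [F] linear up to a small
    multiple of the displacement, and the displacement along the curve is itself of order [h]. *)
Lemma chain_rule (l : nat) (F : vec l -> R -> R) (G : 'I_l -> vec l -> R -> R)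
    (Gphi : vec l -> R -> R) (q : R -> vec l) (phi : R -> R) (t : R) (q' : vec l) (phi' d : R) :
  0 < d ->
  (forall x f, (forall i, Rabs (x i - q t i) < d) ->
     (forall j, deriv (fun s => F (upd x j s) f) (x j) (G j x f)) /\ deriv (F x) f (Gphi x f)) ->
  (forall j, cont_at (G j) (q t) (phi t)) -> cont_at Gphi (q t) (phi t) ->
  (forall i, deriv (fun s => q s i) t (q' i)) -> deriv phi t phi' ->
  deriv (fun s => F (q s) (phi s)) t
    (\rsum_(j < l) (G j (q t) (phi t) * q' j) + Gphi (q t) (phi t) * phi').
Proof.
move=> d0 HF HG HGphi Hq Hphi.
(* [A] is the linearisation of [F] at the base point, evaluated along the curve; it has the claimed
   derivative, so the remainder [B] must have derivative 0. *)
pose A s := \rsum_(j < l) (G j (q t) (phi t) * q s j) + Gphi (q t) (phi t) * phi s.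
pose B s := F (q s) (phi s) - A s.
have HA : deriv A t (\rsum_(j < l) (G j (q t) (phi t) * q' j) + Gphi (q t) (phi t) * phi').
  apply: deriv_add; last exact: deriv_scale.
  by apply: deriv_rsum => j; apply: deriv_scale.
have -> : (fun s => F (q s) (phi s)) = fun s => A s + B s.
  by apply: functional_extensionality => s; rewrite /B; ring.
rewrite -[X in deriv _ _ X]Rplus_0_r; apply: deriv_add => //.
have [k [k0 [dk [dk0 Hk]]]] : exists k, 0 < k /\ exists d, 0 < d /\ forall h, Rabs h < d ->
    (forall j, Rabs (q (t + h) j - q t j) <= k * Rabs h) /\
    Rabs (phi (t + h) - phi t) <= k * Rabs h.
  have [d1 [d10 Hd1]] := deriv_lipschitz_near Hphi.
  have [|d2 [d20 Hd2]] := @uniform_radius l (fun j d => forall h, Rabs h < d ->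
      Rabs (q (t + h) j - q t j) <= (Rabs (q' j) + 1) * Rabs h) _
      (fun j => deriv_lipschitz_near (Hq j)).
    by move=> j e e' [_ he] H h hh; apply: H; lra.
  pose k := \rsum_(j < l) Rabs (q' j) + Rabs phi' + 1.
  have s0 : 0 <= \rsum_(j < l) Rabs (q' j) by apply: rsum_ge0 => j; exact: Rabs_pos.
  have p0 := Rabs_pos phi'.
  exists k; split; first by rewrite /k; lra.
  exists (Rmin d1 d2); split; first exact: Rmin_pos.
  move=> h hh; have := Rmin_l d1 d2; have := Rmin_r d1 d2 => h2 h1; split.
  - move=> j; apply: (Rle_trans _ _ _ (Hd2 j h _)); first lra.
    apply: Rmult_le_compat_r; first exact: Rabs_pos.
    have := @rsum_ge_term l (fun j => Rabs (q' j)) j (fun i => Rabs_pos _); rewrite /k; lra.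
  - apply: (Rle_trans _ _ _ (Hd1 h _)); first lra.
    apply: Rmult_le_compat_r; [exact: Rabs_pos|rewrite /k; lra].
have n0 := pos_INR l.
(* The remainder will be at most [e1 * (l + 1) * k * Rabs h], which is half of [e * Rabs h]; the
   factor 2 in [k'] provides the strict inequality. *)
move=> e e0; set k' := 2 * ((INR l + 1) * k); have k'0 : 0 < k' by rewrite /k'; nra.
pose e1 := e / k'; have e10 : 0 < e1 by apply: Rdiv_lt_0_compat.
have [|d3 [d30 Hd3]] := @uniform_radius l (fun j d => forall x f,
    (forall i, Rabs (x i - q t i) < d) -> Rabs (f - phi t) < d ->
    Rabs (G j x f - G j (q t) (phi t)) < e1) _
    (fun j => cont_at_box (HG j) e10).
  move=> j r r' [_ hr] H x f hx hf; apply: H => [i|]; last lra.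
  by have := hx i; lra.
have [d4 [d40 Hd4]] := cont_at_box HGphi e10.
pose r := Rmin d (Rmin d3 d4); have r0 : 0 < r by do 2 apply: Rmin_pos => //.
have [rd [r3 r4]] : r <= d /\ r <= d3 /\ r <= d4.
  by rewrite /r; have := Rmin_l d (Rmin d3 d4); have := Rmin_r d (Rmin d3 d4);
    have := Rmin_l d3 d4; have := Rmin_r d3 d4; lra.
have d50 : 0 < Rmin dk (r / k) by apply: Rmin_pos => //; apply: Rdiv_lt_0_compat.
exists (mkposreal _ d50) => h h0 /= hh.
have [hq hp] := Hk h (Rlt_le_trans _ _ _ hh (Rmin_l _ _)).
have hr : k * Rabs h < r.
  have := Rmin_r dk (r / k); have : r / k * k = r by field; lra.
  by nra.
have mid a b z : Rmin a b <= z <= Rmax a b -> Rabs (z - a) <= Rabs (b - a).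
  by rewrite /Rmin /Rmax; case: Rle_dec => ab hz; apply: Rabs_le; split_Rabs; lra.
rewrite Rminus_0_r /Rdiv Rabs_mult Rabs_inv.
have habs := Rabs_pos_lt _ h0.
apply: (Rmult_lt_reg_r (Rabs h)) => //.
rewrite Rmult_assoc Rinv_l ?Rmult_1_r; last lra.
(* The increment is split in two: [q] moves first with [phi] frozen, then [phi] moves at the new
   [q]. *)
have H1 : Rabs (F (q (t + h)) (phi t) - F (q t) (phi t)
    - \rsum_(j < l) (G j (q t) (phi t) * (q (t + h) j - q t j)))
    <= e1 * \rsum_(j < l) Rabs (q (t + h) j - q t j).
  apply: (@mean_value_box l (fun x => F x (phi t)) (fun j x => G j x (phi t))) => z hz j.
  have hz' i : Rabs (z i - q t i) < r by have := mid _ _ _ (hz i); have := hq i; lra.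
  split; first by apply: (HF _ _ _).1 => i; have := hz' i; lra.
  apply: Rlt_le; apply: Hd3 => [i|]; first by have := hz' i; lra.
  by rewrite Rminus_diag Rabs_R0.
have H2 : Rabs (F (q (t + h)) (phi (t + h)) - F (q (t + h)) (phi t)
    - Gphi (q t) (phi t) * (phi (t + h) - phi t)) <= e1 * Rabs (phi (t + h) - phi t).
  apply: (@mean_value_dev (F (q (t + h))) (fun f => Gphi (q (t + h)) f)) => f hf.
  have hf' := mid _ _ _ hf.
  split; first by apply: (HF _ _ _).2 => i; have := hq i; lra.
  apply: Rlt_le; apply: Hd4 => [i|]; last lra.
  by have := hq i; lra.
have H3 := rsum_le_const hq.
have -> : B (t + h) - B t = (F (q (t + h)) (phi t) - F (q t) (phi t)
    - \rsum_(j < l) (G j (q t) (phi t) * (q (t + h) j - q t j)))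
   + (F (q (t + h)) (phi (t + h)) - F (q (t + h)) (phi t)
    - Gphi (q t) (phi t) * (phi (t + h) - phi t)).
  rewrite /B /A; under [X in _ = _ - X + _]eq_bigr => j _ do
    rewrite Rmult_minus_distr_l -[_ * q t j]Rmult_1_l /Rminus -Ropp_mult_distr_l_reverse.
  rewrite big_split /= rsum_scale; ring.
apply: (Rle_lt_trans _ _ _ (Rabs_triang _ _)).
have : e1 * k' = e by rewrite /e1; field; lra.
move=> <-; rewrite /k'.
have : e1 * (\rsum_(j < l) Rabs (q (t + h) j - q t j)) <= e1 * (INR l * (k * Rabs h)).
  by apply: Rmult_le_compat_l; lra.
have : e1 * Rabs (phi (t + h) - phi t) <= e1 * (k * Rabs h).
  by apply: Rmult_le_compat_l; lra.
have : 0 < e1 * ((INR l + 1) * k * Rabs h).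
  by do !apply: Rmult_lt_0_compat => //; lra.
nra.
Qed.

(** * Gronwall's inequality and continuation *)

Lemma deriv_le0_le f f' t : 0 <= t ->
  (forall s, 0 <= s <= t -> deriv f s (f' s) /\ f' s <= 0) -> f t <= f 0.
Proof.
move=> [t0|<-] H; last lra.
have [s [e hs]] := MVT_cor2 f f' 0 t t0 (fun s h => proj1 (H s h)).
have : f' s <= 0 by apply: (H s _).2; lra.
by nra.
Qed.

Lemma deriv_zero_const f t : 0 <= t ->
  (forall s, 0 <= s <= t -> deriv f s 0) -> f t = f 0.
Proof.
move=> [t0|<-] H //.
by have [s [e hs]] := MVT_cor2 f (fun _ => 0) 0 t t0 H; lra.
Qed.

(** The product of [y] with the integrating factor [exp (- c * s)] has nonpositive derivative. *)
Lemma gronwall y y' c t : 0 <= t ->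
  (forall s, 0 <= s <= t -> deriv y s (y' s) /\ y' s <= c * y s) ->
  y t <= y 0 * exp (c * t).
Proof.
move=> t0 H.
pose E s := exp (- c * s).
have dE s : deriv E s (E s * (- c * 1)).
  apply: (derivable_pt_lim_comp (fun s => - c * s) exp); last exact: derivable_pt_lim_exp.
  by apply: deriv_scale; exact: derivable_pt_lim_id.
have := @deriv_le0_le (fun s => y s * E s) (fun s => y' s * E s + y s * (E s * (- c * 1))) t t0.
have -> : E 0 = 1 by rewrite /E Rmult_0_r exp_0.
rewrite [y 0 * 1]Rmult_1_r => H1.
have H2 : y t * E t <= y 0.
  apply: H1 => s hs; have [dy le] := H s hs; split; first exact: deriv_mul.
  by have := exp_pos (- c * s); rewrite -/(E s); nra.
have e0 := exp_pos (c * t).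
have -> : y t = y t * E t * exp (c * t).
  rewrite Rmult_assoc -exp_plus; have -> : - c * t + c * t = 0 by ring.
  by rewrite exp_0; ring.
by apply: Rmult_le_compat_r; lra.
Qed.

(** The improvement from [b] to [b / 2] leaves a margin that continuity can spend, so the set of
    times up to which the bound holds can neither lose its supremum nor end before [t1]. *)
Lemma continuity_induction (N : R -> R) (T b : R) :
  0 < b -> N 0 < b -> (forall t, 0 <= t <= T -> continuity_pt N t) ->
  (forall t, 0 <= t <= T -> (forall s, 0 <= s <= t -> N s < b) -> N t <= b / 2) ->
  forall t, 0 <= t <= T -> N t < b.
Proof.
move=> b0 N0 cN step t1 ht1.
have near t e : 0 <= t <= T -> 0 < e ->
    exists d, 0 < d /\ forall s, Rabs (s - t) < d -> Rabs (N s - N t) < e.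
  move=> ht e0; have [d [d0 Hd]] := cN t ht e e0; exists d; split=> // s hs.
  case: (Req_dec s t) => [->|st]; first by rewrite Rminus_diag Rabs_R0.
  by apply: (Hd s); split; [split=> //; exact: not_eq_sym|].
pose E t := 0 <= t <= t1 /\ forall s, 0 <= s <= t -> N s < b.
have E0 : E 0 by split=> [|s hs]; [lra|have -> : s = 0 by lra].
have [|m [ub lub]] := completeness E _ (ex_intro _ 0 E0).
  by exists t1 => t [ht _]; lra.
have m0 : 0 <= m := ub 0 E0.
have mt : m <= t1 by apply: lub => t [ht _]; lra.
have below s : 0 <= s < m -> N s < b.
  move=> hs; case: (Rlt_le_dec (N s) b) => // bs.
  have : m <= s; last lra.
  apply: lub => t [ht Ht]; apply: Rnot_lt_le => st.
  by have := Ht s; lra.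
have Nm : N m < b.
  case: (Rlt_le_dec (N m) b) => // bm.
  have m1 : 0 < m by case: m0 => // m0; rewrite -m0 in bm; lra.
  (* Just left of [m] the improved bound gives [N s <= b / 2], and continuity lets [N] rise by less
     than [b / 2] between [s] and [m]. Taking [Rmin m d] keeps [s] positive. *)
  have [d [d0 Hd]] := near m (b / 2) ltac:(lra) ltac:(lra).
  pose s := m - Rmin m d / 2.
  have r0 := Rmin_pos _ _ m1 d0; have r1 := Rmin_l m d; have r2 := Rmin_r m d.
  have : N s <= b / 2.
    by apply: step => [|r hr]; [rewrite /s; lra|apply: below; rewrite /s in hr; lra].
  have : Rabs (N s - N m) < b / 2 by apply: Hd; rewrite /s; split_Rabs; lra.
  by split_Rabs; lra.
have [d [d0 Hd]] := near m (b - N m) ltac:(lra) ltac:(lra).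
case: (Rle_lt_or_eq_dec _ _ mt) => [mt1|<-//].
(* If [m < t1], the bound persists up to this later time [s], contradicting that [m] is an upper
   bound. *)
pose s := Rmin (m + d / 2) t1.
have s1 : s <= t1 := Rmin_r _ _.
have s2 : s <= m + d / 2 := Rmin_l _ _.
have s3 : m < s by apply: Rmin_glb_lt; lra.
have : s <= m; last lra.
apply: ub; split=> [|r hr]; first lra.
case: (Rlt_le_dec r m) => rm; first by apply: below; lra.
have : Rabs (N r - N m) < b - N m by apply: Hd; split_Rabs; lra.
by split_Rabs; lra.
Qed.

(** * Dot products and estimates for the potential part of the energy *)

Lemma rsum_sub (I : Type) (s : seq I) (f g : I -> R) :
  \big[Rplus/0]_(i <- s) f i - \big[Rplus/0]_(i <- s) g i = \big[Rplus/0]_(i <- s) (f i - g i).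
Proof.
elim: s => [|i s IH]; first by rewrite !big_nil; ring.
by rewrite !big_cons -IH; ring.
Qed.

Lemma dot_scaler (l : nat) (u v : vec l) (c : R) : dot u (fun i => c * v i) = c * dot u v.
Proof. by rewrite -rsum_scale; apply: eq_bigr => i _; ring. Qed.

Lemma dot_addr (l : nat) (u v w : vec l) : dot u (fun i => v i + w i) = dot u v + dot u w.
Proof. by rewrite /dot -big_split; apply: eq_bigr => i _; rewrite /=; ring. Qed.

Lemma dotC (l : nat) (u v : vec l) : dot u v = dot v u.
Proof. by apply: eq_bigr => i _; ring. Qed.

Lemma deriv_dot (l : nat) (u v : R -> vec l) (t : R) (u' v' : vec l) :
  (forall i, deriv (fun s => u s i) t (u' i)) -> (forall i, deriv (fun s => v s i) t (v' i)) ->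
  deriv (fun s => dot (u s) (v s)) t (dot u' (v t) + dot (u t) v').
Proof.
move=> Hu Hv.
have -> : dot u' (v t) + dot (u t) v' = \rsum_(i < l) (u' i * v t i + u t i * v' i).
  by rewrite big_split.
by apply: deriv_rsum => i; apply: deriv_mul.
Qed.

Lemma Rabs_dot_le (l : nat) (u v : vec l) (a b : R) :
  (forall i, Rabs (u i) <= a) -> (forall i, Rabs (v i) <= b) ->
  Rabs (dot u v) <= INR l * (a * b).
Proof.
move=> Hu Hv; apply: Rabs_rsum_le => i; rewrite Rabs_mult.
by apply: Rmult_le_compat; try exact: Rabs_pos.
Qed.

Lemma Rabs_mul_sub_le a b a' b' x y x0 y0 :
  Rabs (a - a') <= x -> Rabs b <= y -> Rabs a' <= x0 -> Rabs (b - b') <= y0 ->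
  Rabs (a * b - a' * b') <= x * y + x0 * y0.
Proof.
move=> H1 H2 H3 H4.
have -> : a * b - a' * b' = (a - a') * b + a' * (b - b') by ring.
apply: (Rle_trans _ _ _ (Rabs_triang _ _)); rewrite !Rabs_mult.
by apply: Rplus_le_compat; apply: Rmult_le_compat => //; exact: Rabs_pos.
Qed.

Lemma Rabs_dot_sub_le (l : nat) (u v u' v' : vec l) x y x0 y0 :
  (forall i, Rabs (u i - u' i) <= x) -> (forall i, Rabs (v i) <= y) ->
  (forall i, Rabs (u' i) <= x0) -> (forall i, Rabs (v i - v' i) <= y0) ->
  Rabs (dot u v - dot u' v') <= INR l * (x * y + x0 * y0).
Proof.
move=> H1 H2 H3 H4; rewrite /dot rsum_sub; apply: Rabs_rsum_le => i.
exact: Rabs_mul_sub_le.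
Qed.

(* The common shape of the Hamiltonian minus its kinetic part and of all its
   partial derivatives in [q] and [phi]. *)
Definition pot {l : nat} (A : vec l) (h u : R) (p : vec l) (g : R) : R :=
  g * dot A p + / 2 * h * g ^ 2 + u.

(** Linearity in the coefficient triple isolates the order-eps part of the energy and of the
    forces. *)
Lemma pot_add_scale (l : nat) (A A1 : vec l) h h1 u u1 p g c :
  pot (fun i => A i + c * A1 i) (h + c * h1) (u + c * u1) p g
  = pot A h u p g + c * pot A1 h1 u1 p g.
Proof.
by rewrite /pot ![dot _ p]dotC dot_addr dot_scaler; ring.
Qed.

Lemma Rabs_pot_le (l : nat) (A : vec l) h u p g m B G :
  (forall i, Rabs (A i) <= m) -> Rabs h <= m -> Rabs u <= m ->
  (forall i, Rabs (p i) <= B) -> Rabs g <= G ->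
  Rabs (pot A h u p g) <= m * (G * INR l * B + G * G + 1).
Proof.
move=> HA Hh Hu Hp Hg; rewrite /pot.
have H1 : Rabs (g * dot A p) <= G * (INR l * (m * B)).
  rewrite Rabs_mult; apply: Rmult_le_compat => //; try exact: Rabs_pos.
  exact: Rabs_dot_le.
have H2 : Rabs (h * g ^ 2) <= m * (G * G).
  rewrite Rabs_mult; apply: Rmult_le_compat => //; try exact: Rabs_pos.
  rewrite -[g ^ 2]Rsqr_pow2 /Rsqr Rabs_mult.
  by apply: Rmult_le_compat => //; exact: Rabs_pos.
have H3 : Rabs (g * dot A p + / 2 * h * g ^ 2 + u)
    <= Rabs (g * dot A p) + Rabs (h * g ^ 2) + Rabs u.
  rewrite Rmult_assoc; set x := g * _; set y := h * _.
  by split_Rabs; lra.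
by lra.
Qed.

(** One number [r] measures the distance between the two states, and [k] is a Lipschitz constant of
    the coefficients; the bound is the telescoped difference of each product. *)
Lemma Rabs_pot_sub_le (l : nat) (A A' : vec l) h h' u u' p p' g g' m k B G r :
  (forall i, Rabs (A i - A' i) <= k * r) -> Rabs (h - h') <= k * r -> Rabs (u - u') <= k * r ->
  (forall i, Rabs (p i - p' i) <= r) -> Rabs (g - g') <= r ->
  (forall i, Rabs (A' i) <= m) -> Rabs h' <= m ->
  (forall i, Rabs (p i) <= B) -> (forall i, Rabs (p' i) <= B) -> Rabs g <= G -> Rabs g' <= G ->
  Rabs (pot A h u p g - pot A' h' u' p' g')
    <= (G * INR l * (k * B + m) + INR l * m * B + k * (G * G) + m * G + k) * r.
Proof.
move=> HA Hh Hu Hp Hg bA bh bp bp' bg bg'.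
have D1 := Rabs_dot_sub_le HA bp bA Hp.
have D2 := Rabs_dot_le bA bp'.
have G2 : Rabs (g * g - g' * g') <= r * G + G * r by apply: Rabs_mul_sub_le.
have G3 : Rabs (g * g) <= G * G.
  by rewrite Rabs_mult; apply: Rmult_le_compat => //; exact: Rabs_pos.
have T1 := Rabs_mul_sub_le (b' := g * dot A' p') D1 bg.
have T2 : Rabs (dot A p * g - dot A' p' * g')
    <= INR l * (k * r * B + m * r) * G + INR l * (m * B) * r by apply: Rabs_mul_sub_le.
have T3 : Rabs (h * (g * g) - h' * (g' * g')) <= k * r * (G * G) + m * (r * G + G * r).
  exact: Rabs_mul_sub_le.
rewrite /pot.
have -> : g * dot A p + / 2 * h * g ^ 2 + u - (g' * dot A' p' + / 2 * h' * g' ^ 2 + u')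
   = (dot A p * g - dot A' p' * g') + / 2 * (h * (g * g) - h' * (g' * g')) + (u - u') by field.
move: T2 T3 Hu; set x := _ - _; set y := _ - _; set z := u - u' => T2 T3 Hu.
have r0 : 0 <= r by apply: (Rle_trans _ _ _ (Rabs_pos _) Hg).
have G0 : 0 <= G by apply: (Rle_trans _ _ _ (Rabs_pos _) bg).
have kr : 0 <= k * r by apply: (Rle_trans _ _ _ (Rabs_pos _) Hh).
have P1 : 0 <= k * r * (G * G) by apply: Rmult_le_pos => //; apply: Rmult_le_pos.
have : Rabs (x + / 2 * y + z) <= Rabs x + / 2 * Rabs y + Rabs z by split_Rabs; lra.
by lra.
Qed.

(** With [L] the gradient of the potential part in [q], the terms in [p'] sum to
    [- eps * (p + g A) . L], which is minus [L . q'] and cancels the change of the potential part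
    due to [q']. What is left is exactly the last hypothesis, so the two flows differ only in how
    they satisfy it. *)
Lemma energy_balance (l : nat) (A A' p p' q' dh du bA : vec l) (dA : 'I_l -> vec l)
    (h h' u' g g' bh bu phi' eps : R) :
  (forall i, q' i = eps * (p i + g * A i)) ->
  (forall j, p' j = - eps * pot (dA j) (dh j) (du j) p g) ->
  (forall i, A' i = \rsum_(j < l) (dA j i * q' j) + bA i * phi') ->
  h' = \rsum_(j < l) (dh j * q' j) + bh * phi' ->
  u' = \rsum_(j < l) (du j * q' j) + bu * phi' ->
  g' * (dot A p + h * g) + phi' * pot bA bh bu p g = 0 ->
  dot p p' + (g' * dot A p + g * (dot A' p + dot A p')) + / 2 * (h' * g ^ 2 + h * (2 * g * g')) + u'
  = 0.
Proof.
move=> Eq Ep EA -> -> Eg.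
pose L j := pot (dA j) (dh j) (du j) p g.
have p'E : p' = fun j => - eps * L j by apply: functional_extensionality => j; exact: Ep.
have e1 : dot p p' = - eps * dot p L by rewrite p'E dot_scaler.
have e2 : dot A p' = - eps * dot A L by rewrite p'E dot_scaler.
have e3 : dot L q' = eps * (dot p L + g * dot A L).
  have -> : q' = fun i => eps * (p i + g * A i) by apply: functional_extensionality.
  by rewrite dot_scaler dot_addr dot_scaler ![dot L _]dotC.
(* Exchanging the sums over components and over directions collects the derivatives of [A] by
   direction, as in [L]. *)
have e4 : dot A' p = \rsum_(j < l) (q' j * dot (dA j) p) + phi' * dot bA p.
  rewrite /dot; under eq_bigr => i _ do rewrite EA Rmult_plus_distr_r.
  rewrite big_split /=; congr (_ + _); last first.
    by rewrite -rsum_scale; apply: eq_bigr => i _; ring.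
  under [RHS]eq_bigr => j _ do rewrite -rsum_scale.
  rewrite exchange_big /=; apply: eq_bigr => i _.
  by rewrite Rmult_comm -rsum_scale; apply: eq_bigr => j _; ring.
have e5 : dot L q' = g * (\rsum_(j < l) (q' j * dot (dA j) p))
    + (/ 2 * g ^ 2 * (\rsum_(j < l) (dh j * q' j)) + \rsum_(j < l) (du j * q' j)).
  rewrite -!rsum_scale -!big_split /=; apply: eq_bigr => j _.
  by rewrite /L /pot /=; ring.
rewrite e1 e2 e4.
move: Eg; rewrite /pot => Eg.
set S1 := \rsum_(j < l) (q' j * _) in e5 *.
set S2 := \rsum_(j < l) (dh j * _) in e5 *.
set S3 := \rsum_(j < l) (du j * _) in e5 *.
by nra.
Qed.

(** * Derivatives and Lipschitz bounds extracted from the regularity hypotheses *)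

(** Selects derivatives that [CkB] and the solution predicates only assert to exist, one index at a
    time. *)
Lemma functional_choice (A : Type) (B : A -> Type) (P : forall x, B x -> Prop) :
  (forall x, exists y, P x y) -> exists f : forall x, B x, forall x, P x (f x).
Proof.
move=> H; exists (fun x => proj1_sig (constructive_indefinite_description _ (H x))) => x.
exact: proj2_sig.
Qed.

Lemma cont_at_add_scale (l : nat) (F G : vec l -> R -> R) (q : vec l) (phi c : R) :
  cont_at F q phi -> cont_at G q phi -> cont_at (fun x f => F x f + c * G x f) q phi.
Proof.
move=> HF HG e e0.
have [d1 [d10 Hd1]] := HF (e / 2) ltac:(lra).
have k0 : 0 < 2 * (Rabs c + 1) by have := Rabs_pos c; lra.
have [d2 [d20 Hd2]] := HG (e / (2 * (Rabs c + 1))) (Rdiv_lt_0_compat _ _ e0 k0).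
exists (Rmin d1 d2); split; first exact: Rmin_pos.
move=> x f hx.
have {}Hd1 := Hd1 x f (Rlt_le_trans _ _ _ hx (Rmin_l _ _)).
have {}Hd2 := Hd2 x f (Rlt_le_trans _ _ _ hx (Rmin_r _ _)).
set u := F x f - F q phi in Hd1; set v := G x f - G q phi in Hd2.
have -> : F x f + c * G x f - (F q phi + c * G q phi) = u + c * v by rewrite /u /v; ring.
apply: (Rle_lt_trans _ _ _ (Rabs_triang _ _)); rewrite Rabs_mult.
have : e / (2 * (Rabs c + 1)) * (Rabs c + 1) = e / 2 by field; have := Rabs_pos c; lra.
have := Rabs_pos c; have := Rabs_pos v; nra.
Qed.

(** What the chain rule consumes. [S] restricts [q] alone because the data live on a full circle in
    [phi]. *)
Definition partials {l : nat} (S : vec l -> Prop) (F : vec l -> R -> R)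
    (dF : 'I_l -> vec l -> R -> R) (bF : vec l -> R -> R) : Prop :=
  forall q phi, S q ->
    [/\ forall j, deriv (fun s => F (upd q j s) phi) (q j) (dF j q phi),
        deriv (F q) phi (bF q phi),
        forall j, cont_at (dF j) q phi & cont_at bF q phi].

Lemma partials_add_scale (l : nat) (S : vec l -> Prop) F dF bF G dG bG c :
  partials S F dF bF -> partials S G dG bG ->
  partials S (fun q phi => F q phi + c * G q phi)
    (fun j q phi => dF j q phi + c * dG j q phi) (fun q phi => bF q phi + c * bG q phi).
Proof.
move=> HF HG q phi Sq; have [F1 F2 F3 F4] := HF q phi Sq; have [G1 G2 G3 G4] := HG q phi Sq.
split=> [j||j|].
- by apply: deriv_add => //; apply: deriv_scale.
- by apply: deriv_add => //; apply: deriv_scale.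
- exact: cont_at_add_scale.
- exact: cont_at_add_scale.
Qed.

Lemma CkB_weaken (l k : nat) (S : vec l -> R -> Prop) (M M' : R) (F : vec l -> R -> R) :
  M <= M' -> CkB k S M F -> CkB k S M' F.
Proof.
move=> MM; elim: k F => [|k IH] F /= [H1 H2]; split.
- by move=> q phi Sq; have [] := H1 q phi Sq; split=> //; lra.
- by [].
- by move=> q phi Sq; have [] := H1 q phi Sq; split=> //; lra.
- case: H2 => Hq [G [G1 G2]]; split; last by exists G; split=> //; exact: IH.
  by move=> j; have [G' [G1' G2']] := Hq j; exists G'; split=> //; exact: IH.
Qed.

Lemma CkB_bound (l k : nat) (S : vec l -> R -> Prop) (M : R) (F : vec l -> R -> R) q phi :
  CkB k S M F -> S q phi -> Rabs (F q phi) <= M.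
Proof. by case: k => [|k] [H _] Sq; case: (H q phi Sq). Qed.

Lemma CkB_cont (l k : nat) (S : vec l -> R -> Prop) (M : R) (F : vec l -> R -> R) q phi :
  CkB k S M F -> S q phi -> cont_at F q phi.
Proof. by case: k => [|k] [H _] Sq; case: (H q phi Sq). Qed.

Lemma CkB_partials (l k : nat) (S : vec l -> Prop) (M : R) (F : vec l -> R -> R) :
  CkB k.+1 (fun q _ => S q) M F ->
  exists dF bF, [/\ partials S F dF bF, forall j, CkB k (fun q _ => S q) M (dF j)
    & CkB k (fun q _ => S q) M bF].
Proof.
move=> [_ [/functional_choice [dF HdF] [bF [H1 H2]]]].
exists dF, bF; split=> // [q phi Sq|j]; last by case: (HdF j).
split.
- by move=> j; case: (HdF j) => H _; apply: H.
- exact: H1.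
- by move=> j; case: (HdF j) => _ H; apply: CkB_cont H _.
- exact: CkB_cont H2 _.
Qed.

(** The path of [mean_value_box] runs inside this box instead of along the segment from [x] to [y],
    so Lipschitz bounds are only claimed for pairs whose whole box lies in [S]. *)
Definition box_in {l : nat} (S : vec l -> Prop) (x y : vec l) : Prop :=
  forall z, (forall i, Rmin (x i) (y i) <= z i <= Rmax (x i) (y i)) -> S z.

Definition lipschitz_on_boxes {l : nat} (S : vec l -> Prop) (M : R) (f : vec l -> R) : Prop :=
  forall x y, box_in S x y -> Rabs (f y - f x) <= M * (\rsum_(i < l) Rabs (y i - x i)).

Lemma CkB_lipschitz (l k : nat) (S : vec l -> Prop) (M : R) (F : vec l -> R -> R) (phi : R) :
  CkB k.+1 (fun q _ => S q) M F -> lipschitz_on_boxes S M (fun q => F q phi).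
Proof.
move=> /CkB_partials [dF [bF [HF bdF _]]] x y Hbox.
have := @mean_value_box l (fun q => F q phi) (fun j q => dF j q phi) (fun _ => 0) x y M.
rewrite (_ : \rsum_(i < l) (0 * (y i - x i)) = 0); last first.
  by rewrite rsum_scale; ring.
rewrite Rminus_0_r; apply=> z /Hbox Sz j; split; first by case: (HF z phi Sz).
by rewrite Rminus_0_r; apply: CkB_bound (bdF j) Sz.
Qed.

(** The partials that [CkB] provides for a function of [q] alone may still depend on [phi]; freezing
    [phi] at 0 removes this, and continuity survives because dropping the [phi] term only decreases
    the distance. Two derivatives are spent to make the gradient Lipschitz. *)
Lemma CkB_static (l k : nat) (S : vec l -> Prop) (M : R) (f : vec l -> R) :
  CkB k.+2 (fun q _ => S q) M (fun q _ => f q) ->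
  exists df : 'I_l -> vec l -> R,
    [/\ partials S (fun q _ => f q) (fun j q _ => df j q) (fun _ _ => 0),
        forall j q, S q -> Rabs (df j q) <= M
      & forall j, lipschitz_on_boxes S M (df j)].
Proof.
move=> /CkB_partials [dF [bF [HF bdF _]]]; exists (fun j q => dF j q 0); split.
- move=> q phi Sq; have [H1 _ H3 _] := HF q 0 Sq; split=> //.
  + exact: deriv_cst.
  + move=> j e e0; have [d [d0 Hd]] := H3 j e e0; exists d; split=> // q' phi' hd.
    apply: Hd; apply: Rle_lt_trans hd; apply: sqrt_le_1_alt.
    by have := pow2_ge_0 (phi' - phi); nra.
  + by move=> e e0; exists 1; split=> [|*]; rewrite ?Rminus_diag ?Rabs_R0; lra.
- by move=> j q Sq; apply: CkB_bound (bdF j) Sq.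
- by move=> j; apply: CkB_lipschitz (bdF j).
Qed.

Definition interior_point {l : nat} (S : vec l -> Prop) (q : vec l) : Prop :=
  exists d, 0 < d /\ forall x, (forall i, Rabs (x i - q i) < d) -> S x.

Lemma interior_point_mem (l : nat) (S : vec l -> Prop) (q : vec l) : interior_point S q -> S q.
Proof. by move=> [d [d0]]; apply=> i; rewrite Rminus_diag Rabs_R0. Qed.

Lemma partials_chain_rule (l : nat) (S : vec l -> Prop) F dF bF (q : R -> vec l) (phi : R -> R)
    (t : R) (q' : vec l) (phi' : R) :
  partials S F dF bF -> interior_point S (q t) ->
  (forall i, deriv (fun s => q s i) t (q' i)) -> deriv phi t phi' ->
  deriv (fun s => F (q s) (phi s)) t
    (\rsum_(j < l) (dF j (q t) (phi t) * q' j) + bF (q t) (phi t) * phi').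
Proof.
move=> HF Sq Hq Hphi.
have [_ _ H3 H4] := HF (q t) (phi t) (interior_point_mem Sq).
case: Sq => d [d0 Hd]; apply: (chain_rule d0) => // x f hx.
by have [] := HF x f (Hd x hx).
Qed.

(** * Conservation of energy *)

(** Together with uniqueness of derivatives, this turns the unnamed [L] of [AvgSol] and [FullSol]
    into a [pot] with differentiated coefficients. *)
Lemma deriv_pot (l : nat) (A : R -> vec l) (h u : R -> R) (p : vec l) (g t : R)
    (A' : vec l) (h' u' : R) :
  (forall i, deriv (fun s => A s i) t (A' i)) -> deriv h t h' -> deriv u t u' ->
  deriv (fun s => pot (A s) (h s) (u s) p g) t (pot A' h' u' p g).
Proof.
move=> HA Hh Hu; apply: deriv_add => //; apply: deriv_add.
  apply: deriv_scale; have := deriv_dot HA (fun i => deriv_cst (p i) t).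
  have -> : dot (A t) (fun _ => 0) = 0.
    by rewrite /dot; under eq_bigr => i _ do rewrite Rmult_comm; rewrite rsum_scale; ring.
  by rewrite Rplus_0_r.
have -> : (fun s => / 2 * h s * g ^ 2) = fun s => (/ 2 * g ^ 2) * h s.
  by apply: functional_extensionality => s; ring.
have -> : / 2 * h' * g ^ 2 = (/ 2 * g ^ 2) * h' by ring.
exact: deriv_scale.
Qed.

(** The rates [phi'] and [g'] are left abstract, tied only by the balance condition, so that one
    statement covers the full flow and the averaged flow. *)
Lemma energy_conserved (l : nat) (S : vec l -> Prop)
    (a : vec l -> R -> vec l) (h u : vec l -> R -> R)
    (da : 'I_l -> 'I_l -> vec l -> R -> R) (ba : 'I_l -> vec l -> R -> R)
    (dh du : 'I_l -> vec l -> R -> R) (bh bu : vec l -> R -> R)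
    (eps T : R) (q p : R -> vec l) (phi g phi' g' : R -> R) :
  (forall i, partials S (fun x f => a x f i) (da i) (ba i)) ->
  partials S h dh bh -> partials S u du bu ->
  (forall t, 0 <= t <= T -> interior_point S (q t)) ->
  (forall t, 0 <= t <= T -> forall i,
     deriv (fun s => q s i) t (eps * (p t i + g t * a (q t) (phi t) i))) ->
  (forall t, 0 <= t <= T -> forall j, deriv (fun s => p s j) t
     (- eps * pot (fun i => da i j (q t) (phi t)) (dh j (q t) (phi t)) (du j (q t) (phi t))
        (p t) (g t))) ->
  (forall t, 0 <= t <= T -> deriv phi t (phi' t)) ->
  (forall t, 0 <= t <= T -> deriv g t (g' t)) ->
  (forall t, 0 <= t <= T ->
     g' t * (dot (a (q t) (phi t)) (p t) + h (q t) (phi t) * g t)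
     + phi' t * pot (fun i => ba i (q t) (phi t)) (bh (q t) (phi t)) (bu (q t) (phi t)) (p t) (g t)
     = 0) ->
  forall t, 0 <= t <= T ->
    / 2 * dot (p t) (p t) + pot (a (q t) (phi t)) (h (q t) (phi t)) (u (q t) (phi t)) (p t) (g t)
    = / 2 * dot (p 0) (p 0)
      + pot (a (q 0) (phi 0)) (h (q 0) (phi 0)) (u (q 0) (phi 0)) (p 0) (g 0).
Proof.
move=> Ha Hh Hu HS Dq Dp Dphi Dg Hbal t [t0 tT].
apply: (deriv_zero_const (f := fun s => / 2 * dot (p s) (p s)
  + pot (a (q s) (phi s)) (h (q s) (phi s)) (u (q s) (phi s)) (p s) (g s)) t0) => s hs.
have {}hs : 0 <= s <= T by lra.
set q' := fun i => eps * (p s i + g s * a (q s) (phi s) i).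
set p' := fun j => - eps * pot (fun i => da i j (q s) (phi s)) (dh j (q s) (phi s))
  (du j (q s) (phi s)) (p s) (g s).
pose A' i := \rsum_(j < l) (da i j (q s) (phi s) * q' j) + ba i (q s) (phi s) * phi' s.
have DA i : deriv (fun r => a (q r) (phi r) i) s (A' i).
  by apply: (partials_chain_rule (Ha i)) => //; [exact: HS|exact: Dq|exact: Dphi].
have Dh := partials_chain_rule Hh (HS s hs) (Dq s hs) (Dphi s hs).
have Du := partials_chain_rule Hu (HS s hs) (Dq s hs) (Dphi s hs).
have := energy_balance (fun i => erefl (q' i)) (fun j => erefl (p' j)) (fun i => erefl (A' i))
  (erefl _) (erefl _) (Hbal s hs).
move: Dh Du; rewrite -/q'; set h' := _ + _; set u' := _ + _ => Dh Du Ebal.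
have DAp := deriv_dot DA (Dp s hs).
have Dpp := deriv_dot (Dp s hs) (Dp s hs); rewrite -/p' in DAp Dpp.
(* The target derivative 0 is replaced by the expanded rate of change, so that the sum and product
   rules apply term by term. *)
rewrite -[X in deriv _ _ X]Ebal /pot.
have -> : dot (p s) p' + (g' s * dot (a (q s) (phi s)) (p s)
     + g s * (dot A' (p s) + dot (a (q s) (phi s)) p'))
   + / 2 * (h' * g s ^ 2 + h (q s) (phi s) * (2 * g s * g' s)) + u'
  = / 2 * (dot p' (p s) + dot (p s) p')
    + (g' s * dot (a (q s) (phi s)) (p s) + g s * (dot A' (p s) + dot (a (q s) (phi s)) p')
       + (/ 2 * h' * g s ^ 2 + / 2 * h (q s) (phi s) * (g' s * g s + g s * g' s)) + u').
  by rewrite (dotC p' (p s)); field.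
apply: deriv_add; first exact: deriv_scale.
apply: deriv_add => //; apply: deriv_add; first by apply: deriv_mul => //; exact: Dg.
have -> : (fun r => / 2 * h (q r) (phi r) * g r ^ 2)
    = fun r => / 2 * h (q r) (phi r) * (g r * g r).
  by apply: functional_extensionality => r; ring.
rewrite -[g s ^ 2]/(g s * (g s * 1)) Rmult_1_r.
by apply: deriv_mul; [exact: deriv_scale|apply: deriv_mul; exact: Dg].
Qed.

(** * A priori bound on the averaged momentum *)

Lemma Rabs_le_of_sq x r : 0 <= r -> x * x <= r * r -> Rabs x <= r.
Proof. by move=> r0 H; apply: Rabs_le; nra. Qed.

(** The force is [eps] times a quantity at most linear in [P], so Gronwall over [eps * t <= 1] gives
    a bound chosen before [eps]. *)
Lemma averaged_momentum_bounded (l : nat) (M G : R) (P0 : vec l) : 0 <= M -> 0 <= G ->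
  exists B, 0 <= B /\
  forall (eps t mu : R) (P : R -> vec l) (dA : R -> 'I_l -> vec l) (dh du : R -> vec l),
  0 < eps -> 0 <= t -> eps * t <= 1 -> Rabs mu <= G -> (forall i, P 0 i = P0 i) ->
  (forall s, 0 <= s <= t -> forall j,
     [/\ deriv (fun r => P r j) s (- eps * pot (dA s j) (dh s j) (du s j) (P s) mu),
         forall i, Rabs (dA s j i) <= M, Rabs (dh s j) <= M & Rabs (du s j) <= M]) ->
  forall i, Rabs (P t i) <= B.
Proof.
move=> M0 G0; have n0 := pos_INR l; set n := INR l in n0.
pose c := M * (G * n + G * G + 1).
have Gn : 0 <= G * n by apply: Rmult_le_pos.
have c0 : 0 <= c by apply: Rmult_le_pos => //; nra.
pose k := 2 * (n * c); have k0 : 0 <= k by rewrite /k; have := Rmult_le_pos _ _ n0 c0; lra.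
have PP0 := dot_self_ge0 P0.
have ek := exp_pos k.
(* This bounds the square of each coordinate; being at least 1, it also bounds the coordinate
   itself. *)
exists ((dot P0 P0 + 1) * exp k); split; first by apply: Rmult_le_pos; lra.
move=> eps t mu P dA dh du eps0 t0 et hmu HP H i.
(* The added 1 makes [b = sqrt (y s)] at least 1, so the constant part of the force is absorbed into
   [c * b] and the inequality becomes homogeneous. *)
pose y s := dot (P s) (P s) + 1.
pose P' s j := - eps * pot (dA s j) (dh s j) (du s j) (P s) mu.
have HPs s : 0 <= s <= t -> forall j, deriv (fun r => P r j) s (P' s j).
  by move=> hs j; case: (H s hs j).
have := @gronwall y (fun s => dot (P' s) (P s) + dot (P s) (P' s) + 0) (eps * k) t t0.
have -> : y 0 = dot P0 P0 + 1.
  by rewrite /y (functional_extensionality (P 0) P0 HP).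
move=> Hgr.
have {}Hgr : y t <= (dot P0 P0 + 1) * exp (eps * k * t).
  apply: Hgr => s hs; split.
    by apply: deriv_add; [exact: deriv_dot (HPs s hs) (HPs s hs)|exact: deriv_cst].
  have PP := dot_self_ge0 (P s); set b := sqrt (y s).
  have bb : b * b = y s by apply: sqrt_sqrt; rewrite /y; lra.
  have b0 : 0 <= b := sqrt_pos _.
  have b1 : 1 <= b by rewrite /y in bb; nra.
  have Pb j : Rabs (P s j) <= b.
    by apply: Rabs_le_of_sq => //; rewrite bb /y; have := coord_sq_le_dot (P s) j; lra.
  have P'b j : Rabs (P' s j) <= eps * (c * b).
    rewrite /P' Rabs_mult Rabs_Ropp (Rabs_pos_eq eps); last lra.
    apply: Rmult_le_compat_l; first lra.
    have [_ H1 H2 H3] := H s hs j.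
    apply: (Rle_trans _ _ _ (Rabs_pot_le H1 H2 H3 Pb hmu)); rewrite -/n /c.
    rewrite (Rmult_assoc M); apply: Rmult_le_compat_l => //.
    by nra.
  have /Rabs_le_bounds := Rabs_dot_le Pb P'b; rewrite (dotC (P' s)) -/n.
  have -> : eps * k * y s = 2 * (n * (b * (eps * (c * b)))) by rewrite -bb /k; ring.
  by lra.
apply: Rabs_le_of_sq; first by apply: Rmult_le_pos; lra.
have yt := coord_sq_le_dot (P t) i.
have : exp (eps * k * t) <= exp k.
  case: (Req_dec (eps * k * t) k) => [->|ne]; first lra.
  apply: Rlt_le; apply: exp_increasing.
  have : eps * t * k <= 1 * k by apply: Rmult_le_compat_r.
  by lra.
have : 1 <= exp k by have := exp_ineq1_le k; lra.
set e := exp k in ek *; set e' := exp (eps * k * t) in Hgr *; move=> e1 ee.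
have yb : y t <= (dot P0 P0 + 1) * e.
  by apply: (Rle_trans _ _ _ Hgr); apply: Rmult_le_compat_l; lra.
have b1 : 1 <= (dot P0 P0 + 1) * e by nra.
rewrite /y in yb; set b := _ * e in yb b1 *.
by nra.
Qed.

(** Leading-order data are compared at the two points [q] and [Q], hence the Lipschitz fields; the
    order-eps data of [jet] only have to be bounded. *)
Record static_jet {l : nat} (S : vec l -> Prop) (M : R) (f : vec l -> R)
    (df : 'I_l -> vec l -> R) : Prop := StaticJet {
  sj_partials : partials S (fun q _ => f q) (fun j q _ => df j q) (fun _ _ => 0);
  sj_bound : forall q, S q -> Rabs (f q) <= M;
  sj_dbound : forall j q, S q -> Rabs (df j q) <= M;
  sj_lip : lipschitz_on_boxes S M f;
  sj_dlip : forall j, lipschitz_on_boxes S M (df j) }.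

Record jet {l : nat} (S : vec l -> Prop) (M : R) (F : vec l -> R -> R)
    (dF : 'I_l -> vec l -> R -> R) (bF : vec l -> R -> R) : Prop := Jet {
  j_partials : partials S F dF bF;
  j_bound : forall q phi, S q -> Rabs (F q phi) <= M;
  j_dbound : forall j q phi, S q -> Rabs (dF j q phi) <= M }.

Lemma CkB_static_jet (l : nat) (S : vec l -> Prop) (M : R) (f : vec l -> R) :
  CkB 3 (fun q _ => S q) M (fun q _ => f q) -> exists df, static_jet S M f df.
Proof.
move=> H; have [df [H1 H2 H3]] := CkB_static H; exists df; split=> //.
- by move=> q Sq; apply: (CkB_bound (phi := 0) H Sq).
- exact: (CkB_lipschitz 0 H).
Qed.

Lemma CkB_jet (l : nat) (S : vec l -> Prop) (M : R) (F : vec l -> R -> R) :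
  CkB 3 (fun q _ => S q) M F -> exists d : ('I_l -> vec l -> R -> R) * (vec l -> R -> R),
  jet S M F d.1 d.2.
Proof.
move=> H; have [dF [bF [H1 H2 _]]] := CkB_partials H; exists (dF, bF); split=> //.
- by move=> q phi Sq; apply: CkB_bound H Sq.
- by move=> j q phi Sq; apply: CkB_bound (H2 j) Sq.
Qed.

(** * Deviation between the full and the averaged solution *)

Lemma lipschitz_coord (l : nat) (S : vec l -> Prop) (M r : R) (f : vec l -> R) (x y : vec l) :
  0 <= M -> lipschitz_on_boxes S M f -> box_in S x y -> (forall i, Rabs (y i - x i) <= r) ->
  Rabs (f y - f x) <= M * INR l * r.
Proof.
move=> M0 Hf Hb Hr; apply: (Rle_trans _ _ _ (Hf x y Hb)).
by rewrite Rmult_assoc; apply: Rmult_le_compat_l => //; exact: rsum_le_const.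
Qed.

(* The energy is quadratic in [g], so its increment between [mu] and [g] is
   [g - mu] times the frequency at the midpoint, which is bounded below. *)
Lemma action_deviation (l : nat) (A A1 A' p p' : vec l) (h h1 h' u u1 u' g mu eps C w x y k : R) :
  0 < eps -> 
  / 2 * dot p p + pot (fun i => A i + eps * A1 i) (h + eps * h1) (u + eps * u1) p g
    = / 2 * dot p' p' + pot A' h' u' p' mu + eps * w ->
  Rabs w <= k -> Rabs (pot A1 h1 u1 p mu) <= k ->
  Rabs (dot p p - dot p' p') <= 2 * x ->
  Rabs (pot A h u p mu - pot A' h' u' p' mu) <= y ->
  C < dot (fun i => A i + eps * A1 i) p + (h + eps * h1) * ((g + mu) / 2) ->
  C * Rabs (g - mu) <= x + y + 2 * eps * k.
Proof.
move=> eps0 E hw hk hx hy hC.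
have E1 := pot_add_scale A A1 h h1 u u1 p mu eps.
set om := _ + _ in hC.
have E2 : (g - mu) * om = pot (fun i => A i + eps * A1 i) (h + eps * h1) (u + eps * u1) p g
    - pot (fun i => A i + eps * A1 i) (h + eps * h1) (u + eps * u1) p mu.
  by rewrite /pot /om; field.
set v := pot A1 h1 u1 p mu in E1 hk.
set z := pot A h u p mu in E1 hy; set z' := pot A' h' u' p' mu in E hy.
have E3 : (g - mu) * om = - / 2 * (dot p p - dot p' p') - (z - z') + eps * (w - v) by lra.
have : Rabs (eps * (w - v)) <= eps * (2 * k).
  rewrite Rabs_mult (Rabs_pos_eq eps); last lra.
  by apply: Rmult_le_compat_l; [lra|split_Rabs; lra].
have : C * Rabs (g - mu) <= Rabs ((g - mu) * om).
  rewrite Rabs_mult; have := Rabs_pos (g - mu); have := Rle_abs om.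
  by nra.
rewrite E3; set a := dot p p - _ in hx *; set b := z - z' in hy *; set c := eps * (w - v).
by split_Rabs; lra.
Qed.

(** The quantitative core, conditional on the trajectories staying where the data are controlled;
    the continuation argument later discharges that condition. [K] depends only on [l], [M], [B],
    [G] and [C]. *)
Lemma closeness (l : nat) (M B G C : R) : 0 <= M -> 0 <= B -> 0 <= G -> 0 < C ->
  exists K, 0 < K /\
  forall (S : vec l -> Prop) (a0 : vec l -> vec l) (h0 u0 : vec l -> R)
    (a1 : vec l -> R -> vec l) (h1 u1 : vec l -> R -> R)
    (da0 : 'I_l -> 'I_l -> vec l -> R) (dh0 du0 : 'I_l -> vec l -> R)
    (da1 : 'I_l -> 'I_l -> vec l -> R -> R) (dh1 du1 : 'I_l -> vec l -> R -> R)
    (ba1 : 'I_l -> vec l -> R -> R) (bh1 bu1 : vec l -> R -> R)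
    (eps t mu : R) (Q P q p : R -> vec l) (phi g : R -> R),
  (forall i, static_jet S M (fun x => a0 x i) (da0 i)) ->
  static_jet S M h0 dh0 -> static_jet S M u0 du0 ->
  (forall i, jet S M (fun x f => a1 x f i) (da1 i) (ba1 i)) ->
  jet S M h1 dh1 bh1 -> jet S M u1 du1 bu1 ->
  0 < eps -> 0 <= t -> eps * t <= 1 -> Rabs mu <= G ->
  q 0 = Q 0 -> p 0 = P 0 -> g 0 = mu ->
  (forall s, 0 <= s <= t ->
    [/\ S (Q s), S (q s) & box_in S (Q s) (q s)] /\
    [/\ forall i, Rabs (P s i) <= B, forall i, Rabs (p s i) <= B & Rabs (g s) <= G] /\
    [/\ forall i, deriv (fun r => Q r i) s (eps * (P s i + mu * a0 (Q s) i)),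
        forall j, deriv (fun r => P r j) s
          (- eps * pot (fun i => da0 i j (Q s)) (dh0 j (Q s)) (du0 j (Q s)) (P s) mu),
        forall i, deriv (fun r => q r i) s
          (eps * (p s i + g s * (a0 (q s) i + eps * a1 (q s) (phi s) i)))
      & forall j, deriv (fun r => p r j) s
          (- eps * pot (fun i => da0 i j (q s) + eps * da1 i j (q s) (phi s))
             (dh0 j (q s) + eps * dh1 j (q s) (phi s))
             (du0 j (q s) + eps * du1 j (q s) (phi s)) (p s) (g s))] /\
    [/\ / 2 * dot (P s) (P s) + pot (a0 (Q s)) (h0 (Q s)) (u0 (Q s)) (P s) mu
        = / 2 * dot (P 0) (P 0) + pot (a0 (Q 0)) (h0 (Q 0)) (u0 (Q 0)) (P 0) mu,
        / 2 * dot (p s) (p s)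
          + pot (fun i => a0 (q s) i + eps * a1 (q s) (phi s) i)
             (h0 (q s) + eps * h1 (q s) (phi s)) (u0 (q s) + eps * u1 (q s) (phi s)) (p s) (g s)
        = / 2 * dot (p 0) (p 0)
          + pot (fun i => a0 (q 0) i + eps * a1 (q 0) (phi 0) i)
             (h0 (q 0) + eps * h1 (q 0) (phi 0)) (u0 (q 0) + eps * u1 (q 0) (phi 0)) (p 0) (g 0)
      & C < dot (fun i => a0 (q s) i + eps * a1 (q s) (phi s) i) (p s)
            + (h0 (q s) + eps * h1 (q s) (phi s)) * ((g s + mu) / 2)]) ->
  dot (vsub (q t) (Q t)) (vsub (q t) (Q t)) + dot (vsub (p t) (P t)) (vsub (p t) (P t))
    <= (K * eps) ^ 2 /\ Rabs (g t - mu) <= K * eps.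
Proof.
move=> M0 B0 G0 C0; have n0 := pos_INR l; set n := INR l in n0.
pose k := M * n; have k0 : 0 <= k by apply: Rmult_le_pos.
(* [c1] and [c2] are the constants of [Rabs_pot_sub_le] and [Rabs_pot_le]: they control the
   leading-order difference and the order-eps part of the potential terms. *)
pose c1 := G * n * (k * B + M) + n * M * B + k * (G * G) + M * G + k.
have c10 : 0 <= c1.
  by rewrite /c1; do !apply: Rplus_le_le_0_compat => //;
    do !(apply: Rmult_le_pos => //); do !(apply: Rplus_le_le_0_compat => //);
    do !(apply: Rmult_le_pos => //).
pose c2 := M * (G * n * B + G * G + 1).
have c20 : 0 <= c2.
  apply: Rmult_le_pos => //; have := Rmult_le_pos _ _ (Rmult_le_pos _ _ G0 n0) B0.
  by nra.
(* The energy comparison divided by the frequency bound [C]; it yields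
   [Rabs (g - mu) <= c3 * (r + eps)]. *)
pose c3 := (n * B + c1 + 2 * c2) / C.
have nB : 0 <= n * B by apply: Rmult_le_pos.
have c30 : 0 <= c3 by apply: Rle_mult_inv_pos => //; lra.
(* The first two terms serve the difference of the momentum equations, the bracket that of the
   position equations. *)
pose c4 := c1 * (1 + c3) + c2 + (1 + k * G + M * c3 + M * G).
have c13 := Rmult_le_pos _ _ c10 c30; have kG := Rmult_le_pos _ _ k0 G0.
have Mc3 := Rmult_le_pos _ _ M0 c30; have MG := Rmult_le_pos _ _ M0 G0.
have c40 : 0 <= c4 by rewrite /c4; lra.
pose k5 := 8 * (n * c4); have k50 : 0 <= k5 by have := Rmult_le_pos _ _ n0 c40; rewrite /k5; lra.
have ek1 : 1 <= exp k5 by have := exp_ineq1_le k5; lra.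
exists ((c3 + 1) * (exp k5 + 1)); split; first by apply: Rmult_lt_0_compat; lra.
move=> S a0 h0 u0 a1 h1 u1 da0 dh0 du0 da1 dh1 du1 ba1 bh1 bu1 eps t mu Q P q p phi g.
move=> Ja0 Jh0 Ju0 Ja1 Jh1 Ju1 eps0 t0 et hmu q0 p0 g0 H.
pose E s := dot (vsub (q s) (Q s)) (vsub (q s) (Q s)) + dot (vsub (p s) (P s)) (vsub (p s) (P s)).
pose r s := sqrt (E s).
have E0 s : 0 <= E s by apply: Rplus_le_le_0_compat; exact: dot_self_ge0.
have r0 s : 0 <= r s := sqrt_pos _.
have rr s : r s * r s = E s := sqrt_sqrt _ (E0 s).
have hq s i : Rabs (q s i - Q s i) <= r s.
  apply: Rabs_le_of_sq => //; rewrite rr /E.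
  have := coord_sq_le_dot (vsub (q s) (Q s)) i; have := dot_self_ge0 (vsub (p s) (P s)).
  by rewrite /vsub; lra.
have hp s i : Rabs (p s i - P s i) <= r s.
  apply: Rabs_le_of_sq => //; rewrite rr /E.
  have := coord_sq_le_dot (vsub (p s) (P s)) i; have := dot_self_ge0 (vsub (q s) (Q s)).
  by rewrite /vsub; lra.
have hg s : 0 <= s <= t -> Rabs (g s - mu) <= c3 * (r s + eps).
  move=> hs; have [[SQ Sq Sb] [[bP bp bg] [_ [Eavg Efull freq]]]] := H s hs.
  have [[SQ0 _ _] [[bP0 _ _] _]] := H 0 ltac:(lra).
  (* Both energies are carried back to time 0, where the states coincide, so they differ exactly by
     the order-eps part at the initial point. *)
  have Ef : / 2 * dot (p s) (p s) + pot (fun i => a0 (q s) i + eps * a1 (q s) (phi s) i)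
       (h0 (q s) + eps * h1 (q s) (phi s)) (u0 (q s) + eps * u1 (q s) (phi s)) (p s) (g s)
     = / 2 * dot (P s) (P s) + pot (a0 (Q s)) (h0 (Q s)) (u0 (Q s)) (P s) mu
       + eps * pot (a1 (Q 0) (phi 0)) (h1 (Q 0) (phi 0)) (u1 (Q 0) (phi 0)) (P 0) mu.
    by rewrite Efull Eavg q0 p0 g0 pot_add_scale; ring.
  have dpp : Rabs (dot (p s) (p s) - dot (P s) (P s)) <= 2 * (n * B * r s).
    apply: (Rle_trans _ _ _ (Rabs_dot_sub_le (hp s) bp bP (hp s))); rewrite -/n; lra.
  have dpot : Rabs (pot (a0 (q s)) (h0 (q s)) (u0 (q s)) (p s) mu
      - pot (a0 (Q s)) (h0 (Q s)) (u0 (Q s)) (P s) mu) <= c1 * r s.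
    apply: (Rabs_pot_sub_le (k := k)) => //.
    - by move=> i; apply: (lipschitz_coord M0 (sj_lip (Ja0 i)) Sb (hq s)).
    - exact: (lipschitz_coord M0 (sj_lip Jh0) Sb (hq s)).
    - exact: (lipschitz_coord M0 (sj_lip Ju0) Sb (hq s)).
    - by rewrite Rminus_diag Rabs_R0.
    - by move=> i; apply: (sj_bound (Ja0 i)).
    - exact: (sj_bound Jh0).
  have := action_deviation eps0 Ef
    (Rabs_pot_le (fun i => j_bound (Ja1 i) (phi 0) SQ0) (j_bound Jh1 (phi 0) SQ0)
       (j_bound Ju1 (phi 0) SQ0) bP0 hmu)
    (Rabs_pot_le (fun i => j_bound (Ja1 i) (phi s) Sq) (j_bound Jh1 (phi s) Sq)
       (j_bound Ju1 (phi s) Sq) bp hmu) dpp dpot freq.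
  rewrite -/n -/c2 => Hdev; apply: (Rmult_le_reg_l C) => //.
  have -> : C * (c3 * (r s + eps)) = (n * B + c1 + 2 * c2) * (r s + eps).
    by rewrite /c3; field; lra.
  have := Rmult_le_pos _ _ nB (Rlt_le _ _ eps0); have := Rmult_le_pos _ _ c10 (Rlt_le _ _ eps0).
  by have := Rmult_le_pos _ _ c20 (r0 s); lra.
pose Q' s i := eps * (P s i + mu * a0 (Q s) i).
pose P' s j := - eps * pot (fun i => da0 i j (Q s)) (dh0 j (Q s)) (du0 j (Q s)) (P s) mu.
pose q' s i := eps * (p s i + g s * (a0 (q s) i + eps * a1 (q s) (phi s) i)).
pose p' s j := - eps * pot (fun i => da0 i j (q s) + eps * da1 i j (q s) (phi s))
             (dh0 j (q s) + eps * dh1 j (q s) (phi s))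
             (du0 j (q s) + eps * du1 j (q s) (phi s)) (p s) (g s).
have hq' s : 0 <= s <= t -> forall i, Rabs (vsub (q' s) (Q' s) i) <= eps * (c4 * (r s + eps)).
  move=> hs i; have [[SQ Sq Sb] [[bP bp bg] _]] := H s hs.
  have {}hg := hg s hs; have rs := r0 s.
  rewrite /vsub /q' /Q' -Rmult_minus_distr_l Rabs_mult (Rabs_pos_eq eps); last lra.
  apply: Rmult_le_compat_l; first lra.
  have T1 : Rabs (a0 (q s) i * g s - a0 (Q s) i * mu) <= k * r s * G + M * (c3 * (r s + eps)).
    apply: Rabs_mul_sub_le => //; last exact: (sj_bound (Ja0 i)).
    exact: (lipschitz_coord M0 (sj_lip (Ja0 i)) Sb (hq s)).
  have T2 : Rabs (a1 (q s) (phi s) i * g s) <= M * G.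
    rewrite Rabs_mult; apply: Rmult_le_compat => //; try exact: Rabs_pos.
    exact: (j_bound (Ja1 i)).
  have T3 := hp s i.
  have -> : p s i + g s * (a0 (q s) i + eps * a1 (q s) (phi s) i) - (P s i + mu * a0 (Q s) i)
    = (p s i - P s i) + (a0 (q s) i * g s - a0 (Q s) i * mu) + eps * (a1 (q s) (phi s) i * g s).
    by ring.
  apply: (Rle_trans _ _ _ (Rabs_triang _ _)).
  rewrite (Rabs_mult eps) (Rabs_pos_eq eps); last lra.
  have T4 := Rabs_triang (p s i - P s i) (a0 (q s) i * g s - a0 (Q s) i * mu).
  have T5 : eps * Rabs (a1 (q s) (phi s) i * g s) <= eps * (M * G).
    by apply: Rmult_le_compat_l => //; lra.
  rewrite /c4.
  have re : 0 <= r s + eps by lra.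
  have := Rmult_le_pos _ _ c13 re; have := Rmult_le_pos _ _ c20 re.
  have := Rmult_le_pos _ _ c10 re; have := Rmult_le_pos _ _ kG (Rlt_le _ _ eps0).
  have := Rmult_le_pos _ _ MG rs.
  by lra.
have hp' s : 0 <= s <= t -> forall j, Rabs (vsub (p' s) (P' s) j) <= eps * (c4 * (r s + eps)).
  move=> hs j; have [[SQ Sq Sb] [[bP bp bg] _]] := H s hs.
  have {}hg := hg s hs; have rs := r0 s.
  rewrite /vsub /p' /P' -Rmult_minus_distr_l Rabs_mult Rabs_Ropp (Rabs_pos_eq eps); last lra.
  apply: Rmult_le_compat_l; first lra.
  (* A common bound for the deviations of [q], [p] and [g], as [Rabs_pot_sub_le] requires. *)
  set rho := r s + c3 * (r s + eps).
  have rer : r s <= rho by rewrite /rho; have := Rmult_le_pos _ _ c30 (r0 s); nra.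
  have krer : k * r s <= k * rho by apply: Rmult_le_compat_l.
  have T1 : Rabs (pot (fun i => da0 i j (q s)) (dh0 j (q s)) (du0 j (q s)) (p s) (g s)
     - pot (fun i => da0 i j (Q s)) (dh0 j (Q s)) (du0 j (Q s)) (P s) mu) <= c1 * rho.
    apply: (Rabs_pot_sub_le (k := k)) => //.
    - move=> i; apply: Rle_trans krer.
      exact: (lipschitz_coord M0 (sj_dlip (Ja0 i) j) Sb (hq s)).
    - apply: Rle_trans krer; exact: (lipschitz_coord M0 (sj_dlip Jh0 j) Sb (hq s)).
    - apply: Rle_trans krer; exact: (lipschitz_coord M0 (sj_dlip Ju0 j) Sb (hq s)).
    - by move=> i; apply: Rle_trans rer; exact: hp.
    - by rewrite /rho; lra.
    - by move=> i; apply: (sj_dbound (Ja0 i)).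
    - exact: (sj_dbound Jh0).
  have T2 : Rabs (pot (fun i => da1 i j (q s) (phi s)) (dh1 j (q s) (phi s))
      (du1 j (q s) (phi s)) (p s) (g s)) <= c2.
    apply: (Rabs_pot_le _ _ _ bp bg).
    - by move=> i; apply: (j_dbound (Ja1 i)).
    - exact: (j_dbound Jh1).
    - exact: (j_dbound Ju1).
  rewrite pot_add_scale; move: T1 T2; set x := pot _ _ _ _ _; set y := pot _ _ _ _ mu.
  set z := pot _ _ _ _ _ => T1 T2.
  have -> : x + eps * z - y = (x - y) + eps * z by ring.
  apply: (Rle_trans _ _ _ (Rabs_triang _ _)).
  rewrite (Rabs_mult eps) (Rabs_pos_eq eps); last lra.
  have T5 : eps * Rabs z <= eps * c2 by apply: Rmult_le_compat_l => //; lra.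
  rewrite /c4; rewrite /rho in T1.
  have re : 0 <= r s + eps by lra.
  have := Rmult_le_pos _ _ kG re; have := Rmult_le_pos _ _ Mc3 re; have := Rmult_le_pos _ _ MG re.
  have := Rmult_le_pos _ _ c20 rs; have := Rmult_le_pos _ _ c10 (Rlt_le _ _ eps0).
  by lra.
have E00 : E 0 = 0.
  rewrite /E q0 p0; have z (x : vec l) : dot (vsub x x) (vsub x x) = 0.
    by rewrite /dot /vsub; apply: big1 => i _; ring.
  by rewrite !z; ring.
(* Adding [eps * eps] makes the inequality homogeneous: the rate of [E] is at most
   [4 eps n c4 r (r + eps)], and [4 r (r + eps) <= 8 (r^2 + eps^2)], whence the 8 in [k5]. *)
have := @gronwall (fun s => E s + eps * eps) (fun s =>
   (dot (vsub (q' s) (Q' s)) (vsub (q s) (Q s)) + dot (vsub (q s) (Q s)) (vsub (q' s) (Q' s)))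
   + (dot (vsub (p' s) (P' s)) (vsub (p s) (P s)) + dot (vsub (p s) (P s)) (vsub (p' s) (P' s)))
   + 0) (eps * k5) t t0.
rewrite E00 Rplus_0_l => Hgr.
have {}Hgr : E t + eps * eps <= eps * eps * exp (eps * k5 * t).
  apply: Hgr => s hs; split.
    have [_ [_ [[DQ DP Dq Dp] _]]] := H s hs.
    have Dvq i : deriv (fun x => vsub (q x) (Q x) i) s (vsub (q' s) (Q' s) i).
      exact: (deriv_sub (Dq i) (DQ i)).
    have Dvp i : deriv (fun x => vsub (p x) (P x) i) s (vsub (p' s) (P' s) i).
      exact: (deriv_sub (Dp i) (DP i)).
    by apply: deriv_add (deriv_cst _ _); apply: deriv_add; exact: deriv_dot.
  have /Rabs_le_bounds T1 := Rabs_dot_le (u := vsub (q s) (Q s)) (hq s) (hq' s hs).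
  have /Rabs_le_bounds T2 := Rabs_dot_le (u := vsub (p s) (P s)) (hp s) (hp' s hs).
  rewrite (dotC (vsub (q' s) _)) (dotC (vsub (p' s) _)) -rr /k5; rewrite -/n in T1 T2.
  have nc : 0 <= eps * (n * c4) by apply: Rmult_le_pos; [lra|exact: Rmult_le_pos].
  have : 4 * (r s * (r s + eps)) <= 8 * (r s * r s + eps * eps) by nra.
  move=> /(Rmult_le_compat_l _ _ _ nc).
  by lra.
have eee : eps * k5 * t <= k5.
  have : eps * t * k5 <= 1 * k5 by apply: Rmult_le_compat_r.
  by lra.
have {eee} : exp (eps * k5 * t) <= exp k5.
  by case: eee => [/exp_increasing|->]; lra.
set e := exp k5 in ek1 *; set e' := exp _ in Hgr * => ee.
have ep2 : 0 < eps * eps by nra.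
(* Since [e] is at least 1, [e <= e * e] makes the right-hand side a perfect square. *)
have rt : r t <= eps * e.
  rewrite -(Rabs_pos_eq _ (r0 t)); apply: Rabs_le_of_sq; first by nra.
  rewrite rr; have : eps * eps * e' <= eps * eps * (e * e) by apply: Rmult_le_compat_l; nra.
  by lra.
have Ke : eps * (e + 1) <= (c3 + 1) * (e + 1) * eps by have := Rmult_le_pos c3 (eps * (e + 1)) c30; nra.
split.
  rewrite -[_ + _]/(E t) -rr; set K := _ * eps in Ke *.
  have rK : r t <= K by lra.
  by have := r0 t; nra.
have := hg t ltac:(lra).
have : c3 * (r t + eps) <= c3 * (eps * (e + 1)) by apply: Rmult_le_compat_l => //; lra.
by nra.
Qed.

(** * Balls around the averaged orbit, and the theorem *)

Lemma dot_vsub_sym (l : nat) (u v : vec l) :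
  dot (vsub u v) (vsub u v) = dot (vsub v u) (vsub v u).
Proof. by apply: eq_bigr => i _; rewrite /vsub; ring. Qed.

Lemma dot_vsub_self (l : nat) (u : vec l) : dot (vsub u u) (vsub u u) = 0.
Proof. by apply: big1 => i _; rewrite /vsub; ring. Qed.

(** A ball centred at [x] that contains [y] thus contains their whole box, which is how [box_in] is
    obtained in a domain that may fail to be convex. *)
Lemma dot_vsub_box (l : nat) (x y z : vec l) :
  (forall i, Rmin (x i) (y i) <= z i <= Rmax (x i) (y i)) ->
  dot (vsub z x) (vsub z x) <= dot (vsub y x) (vsub y x).
Proof.
move=> H; apply: rsum_le => i; rewrite /vsub.
by have := H i; rewrite /Rmin /Rmax; case: Rle_dec => *; nra.
Qed.

Lemma open_ball_interior (l : nat) (c q : vec l) (d : R) : 0 < d ->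
  dot (vsub q c) (vsub q c) < d * d ->
  interior_point (fun x => dot (vsub x c) (vsub x c) < d * d) q.
Proof.
move=> d0 H; set N := dot _ _ in H.
(* Moving one coordinate by less than [e <= 1] changes its square by at most [e * (2 d + 1)]; the
   final [+ 1] keeps [m] positive for [l = 0] and makes the bound strict. *)
have n0 := pos_INR l; set m := INR l * (2 * d + 1) + 1.
have m1 : 1 <= m by rewrite /m; nra.
pose e := Rmin 1 ((d * d - N) / m).
have e0 : 0 < e by apply: Rmin_pos; [lra|apply: Rdiv_lt_0_compat; lra].
have e1 : e <= 1 := Rmin_l _ _.
have e2 : e <= (d * d - N) / m := Rmin_r _ _.
exists e; split=> // x Hx.
have : dot (vsub x c) (vsub x c) - N <= INR l * (e * (2 * d + 1)).
  rewrite /N /dot rsum_sub; apply: rsum_le_const => i; rewrite /vsub.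
  have /Rabs_le_bounds : Rabs (q i - c i) <= d.
    by apply: Rabs_le_of_sq; [lra|have := coord_sq_le_dot (vsub q c) i; rewrite /vsub -/N; lra].
  have /Rabs_def2 := Hx i; set u := q i - c i; set v := x i - q i.
  have -> : x i - c i = u + v by rewrite /u /v; ring.
  by nra.
have : (d * d - N) / m * m = d * d - N by field; lra.
rewrite /m; have : e * m <= (d * d - N) / m * m by apply: Rmult_le_compat_r; lra.
by rewrite /m; lra.
Qed.

Lemma interior_point_sub (l : nat) (S S' : vec l -> Prop) (q : vec l) :
  (forall x, S x -> S' x) -> interior_point S q -> interior_point S' q.
Proof. by move=> H [d [d0 Hd]]; exists d; split=> // x /Hd /H. Qed.

Lemma vnorm_le (l : nat) (u : vec l) (b : R) : 0 <= b -> dot u u <= b ^ 2 -> vnorm u <= b.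
Proof.
move=> b0 H; rewrite /vnorm -(sqrt_pow2 b) //; exact: sqrt_le_1_alt.
Qed.

Lemma deriv_continuity_pt f t f' : deriv f t f' -> continuity_pt f t.
Proof. by move=> H; apply: derivable_continuous_pt; exists f'. Qed.

Lemma pot0 (l : nat) (p : vec l) (g : R) : pot (fun _ => 0) 0 0 p g = 0.
Proof. by rewrite /pot /dot rsum_scale; ring. Qed.

Unset Implicit Arguments.
Theorem theorem5p2 (l : nat)
  (a0 : vec l -> vec l) (a1 : vec l -> R -> vec l)
  (h0 U0 : vec l -> R) (h1 U1 : vec l -> R -> R)
  (D Ddelta : vec l -> vec l -> R -> Prop) (delta M C eps1 : R)
  (Q0 P0 : vec l) (mu : R) :
  (* 2 pi-periodicity in phi *)
  (forall q phi i, a1 q (phi + 2 * PI) i = a1 q phi i) ->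
  (forall q phi, h1 q (phi + 2 * PI) = h1 q phi) ->
  (forall q phi, U1 q (phi + 2 * PI) = U1 q phi) ->
  (* zero mean in phi *)
  (forall q i, exists pr : Riemann_integrable (fun phi => a1 q phi i) 0 (2 * PI),
      RiemannInt pr = 0) ->
  (forall q, exists pr : Riemann_integrable (fun phi => h1 q phi) 0 (2 * PI),
      RiemannInt pr = 0) ->
  (forall q, exists pr : Riemann_integrable (fun phi => U1 q phi) 0 (2 * PI),
      RiemannInt pr = 0) ->
  (* C^3-bounded data on D x T *)
  (let S := fun q (phi : R) => exists p g, D q p g in
   (forall i, CkB 3 S M (fun q _ => a0 q i)) /\
   (forall i, CkB 3 S M (fun q phi => a1 q phi i)) /\
   CkB 3 S M (fun q _ => h0 q) /\ CkB 3 S M h1 /\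
   CkB 3 S M (fun q _ => U0 q) /\ CkB 3 S M U1) ->
  (* the delta-neighbourhood of D_delta lies in D *)
  0 < delta ->
  (forall q p g q' p' g', Ddelta q p g -> dist_qpg q p g q' p' g' < delta ->
      D q' p' g') ->
  (* fast frequency bounded below by C > 0 on D x T *)
  0 < C -> 0 < eps1 ->
  (forall eps, 0 < eps < eps1 -> forall q phi p g, D q p g ->
      dot (a_eps a0 a1 eps q phi) p + h_eps h0 h1 eps q phi * g > C) ->
  exists eps0 C0, 0 < eps0 /\
    forall eps, 0 < eps < eps0 ->
    forall Q P : R -> vec l,
      AvgSol a0 h0 U0 eps (/ eps) mu Q P ->
      (forall i, Q 0 i = Q0 i) -> (forall i, P 0 i = P0 i) ->
      (forall t, 0 <= t <= / eps -> Ddelta (Q t) (P t) mu) ->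
    forall (q : R -> vec l) (phi : R -> R) (p : R -> vec l) (g : R -> R),
      FullSol a0 a1 h0 U0 h1 U1 eps (/ eps) q phi p g ->
      (forall i, q 0 i = Q0 i) -> (forall i, p 0 i = P0 i) -> g 0 = mu ->
      forall t, 0 <= t <= / eps ->
        Rabs (g t - mu) + vnorm (vsub (q t) (Q t)) + vnorm (vsub (p t) (P t))
          < C0 * eps.
Proof.
move=> _ _ _ _ _ _ HC delta0 HD C0 eps10 freq.
pose S x := exists p g, D x p g.
have {HC} [da0 [dh0 [du0 [da1 [dh1 [du1 [Ja0 [Jh0 [Ju0 [Ja1 [Jh1 Ju1]]]]]]]]]]] :
  exists da0 dh0 du0 da1 dh1 du1,
    (forall i, static_jet S (Rabs M) (fun x => a0 x i) (da0 i)) /\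
    static_jet S (Rabs M) h0 dh0 /\ static_jet S (Rabs M) U0 du0 /\
    (forall i, jet S (Rabs M) (fun x f => a1 x f i) (fst (da1 i)) (snd (da1 i))) /\
    jet S (Rabs M) h1 (fst dh1) (snd dh1) /\ jet S (Rabs M) U1 (fst du1) (snd du1).
  (* [M] has no prescribed sign, whereas the estimates need a nonnegative bound. *)
  have weak F : CkB 3 (fun x _ => S x) M F -> CkB 3 (fun x _ => S x) (Rabs M) F.
    by apply: CkB_weaken; exact: Rle_abs.
  have [Ha0 [Ha1 [Hh0 [Hh1 [HU0 HU1]]]]] := HC.
  have [da0 ?] := functional_choice (fun i => CkB_static_jet (weak _ (Ha0 i))).
  have [da1 ?] := functional_choice (fun i => CkB_jet (weak _ (Ha1 i))).
  have [dh0 ?] := CkB_static_jet (weak _ Hh0); have [du0 ?] := CkB_static_jet (weak _ HU0).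
  have [dh1 ?] := CkB_jet (weak _ Hh1); have [du1 ?] := CkB_jet (weak _ HU1).
  by exists da0, dh0, du0, da1, dh1, du1.
have M0 := Rabs_pos M; set M' := Rabs M in M0 Ja0 Jh0 Ju0 Ja1 Jh1 Ju1.
(* Inside the delta-neighbourhood [g] is bounded by [G], and [p] by the bound on [P] plus delta. *)
pose G := Rabs mu + delta; have hmu := Rabs_pos mu.
have [|B0 [B00 HB]] := @averaged_momentum_bounded l M' G P0 M0; first by rewrite /G; lra.
have [|||K [K0 HK]] := @closeness l M' (B0 + delta) G C M0; rewrite /G; try lra.
(* The cap [delta / (2 * K)] yields [K * eps <= delta / 2], which closes the continuation. Each of
   the three deviations is at most [K * eps]; the [+ 1] makes the total strict. *)
exists (Rmin eps1 (Rmin 1 (delta / (2 * K)))), (3 * K + 1).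
have dK : 0 < delta / (2 * K) by apply: Rdiv_lt_0_compat; lra.
split; first by do 2 apply: Rmin_pos => //; lra.
move=> eps [eps0 epsm].
have [e1 [e2 e3]] : eps < eps1 /\ eps < 1 /\ eps < delta / (2 * K).
  have := Rmin_l eps1 (Rmin 1 (delta / (2 * K))); have := Rmin_r eps1 (Rmin 1 (delta / (2 * K))).
  by have := Rmin_l 1 (delta / (2 * K)); have := Rmin_r 1 (delta / (2 * K)); lra.
have Kd : K * eps <= delta / 2.
  have -> : delta / 2 = K * (delta / (2 * K)) by field; lra.
  by apply: Rmult_le_compat_l; lra.
move=> Q P HA HQ0 HP0 HDd q phi p g HF Hq0 Hp0 Hg0.
set T := / eps in HA HDd HF *.
have eT t : t <= T -> eps * t <= 1.
  move=> tT; have -> : 1 = eps * T by rewrite /T; field; lra.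
  by apply: Rmult_le_compat_l; lra.
have Q0E : q 0 = Q 0 by apply: functional_extensionality => i; rewrite Hq0 HQ0.
have P0E : p 0 = P 0 by apply: functional_extensionality => i; rewrite Hp0 HP0.
(* A position near [Q t] is completed by the averaged momentum and action to a point of [D]. *)
have DS t x : 0 <= t <= T -> dot (vsub x (Q t)) (vsub x (Q t)) < delta * delta -> S x.
  move=> ht hx; exists (P t), mu; apply: (HD _ _ _ _ _ _ (HDd t ht)).
  rewrite /dist_qpg -(sqrt_square delta); last lra.
  rewrite dot_vsub_sym dot_vsub_self Rminus_diag; apply: sqrt_lt_1_alt.
  by have := dot_self_ge0 (vsub x (Q t)); nra.
have QS t : 0 <= t <= T -> interior_point S (Q t).
  move=> ht; apply: (interior_point_sub (fun x => DS t x ht)).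
  by apply: open_ball_interior => //; rewrite dot_vsub_self; nra.
have DQ t : 0 <= t <= T -> forall i, deriv (fun s => Q s i) t (eps * (P t i + mu * a0 (Q t) i)).
  by move=> ht; case: (HA t ht).
have DP t : 0 <= t <= T -> forall j, deriv (fun s => P s j) t
    (- eps * pot (fun i => da0 i j (Q t)) (dh0 j (Q t)) (du0 j (Q t)) (P t) mu).
  move=> ht j; have [_ /(_ j) [L [HL]]] := HA t ht.
  have SQ := interior_point_mem (QS t ht).
  suff HL' : deriv (fun s => Kavg a0 h0 U0 mu (upd (Q t) j s) (P t)) (Q t j)
      (pot (fun i => da0 i j (Q t)) (dh0 j (Q t)) (du0 j (Q t)) (P t) mu).
    by rewrite (deriv_uniq HL HL').
  apply: (deriv_pot (A := fun s => a0 (upd (Q t) j s)) (h := fun s => h0 (upd (Q t) j s))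
    (u := fun s => U0 (upd (Q t) j s))).
  - by move=> i; have [/(_ j)] := sj_partials (Ja0 i) 0 SQ.
  - by have [/(_ j)] := sj_partials Jh0 0 SQ.
  - by have [/(_ j)] := sj_partials Ju0 0 SQ.
have EA t : 0 <= t <= T ->
    / 2 * dot (P t) (P t) + pot (a0 (Q t)) (h0 (Q t)) (U0 (Q t)) (P t) mu
    = / 2 * dot (P 0) (P 0) + pot (a0 (Q 0)) (h0 (Q 0)) (U0 (Q 0)) (P 0) mu.
  (* The averaged flow is run with a dummy angle frozen at 0 and a constant action, so both balance
     terms vanish. *)
  apply: (energy_conserved (a := fun x _ => a0 x) (h := fun x _ => h0 x) (u := fun x _ => U0 x)
    (phi := fun _ => 0) (phi' := fun _ => 0) (g := fun _ => mu) (g' := fun _ => 0)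
    (fun i => sj_partials (Ja0 i)) (sj_partials Jh0) (sj_partials Ju0) QS DQ DP).
  - by move=> s _; exact: deriv_cst.
  - by move=> s _; exact: deriv_cst.
  - by move=> s _; ring.
have PB t : 0 <= t <= T -> forall i, Rabs (P t i) <= B0.
  move=> ht; apply: (HB eps t mu P (fun s j i => da0 i j (Q s)) (fun s j => dh0 j (Q s))
    (fun s j => du0 j (Q s))) => //; try lra; first by apply: eT; lra.
    by rewrite /G; lra.
  move=> s hs j; have hs' : 0 <= s <= T by lra.
  have SQ := interior_point_mem (QS s hs'); split.
  - exact: DP.
  - by move=> i; apply: (sj_dbound (Ja0 i)).
  - exact: (sj_dbound Jh0).
  - exact: (sj_dbound Ju0).
pose E t := dot (vsub (q t) (Q t)) (vsub (q t) (Q t)) + dot (vsub (p t) (P t)) (vsub (p t) (P t)).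
(* The squared distance, not the distance, since it stays differentiable at [t = 0], where the two
   solutions coincide. *)
pose N t := E t + (g t - mu) * (g t - mu).
have main t : 0 <= t <= T -> (forall s, 0 <= s <= t -> N s < delta * delta) ->
    E t <= (K * eps) ^ 2 /\ Rabs (g t - mu) <= K * eps.
  move=> ht HN.
  have HqS s : 0 <= s <= t -> interior_point S (q s).
    move=> hs; apply: (interior_point_sub (fun x => DS s x ltac:(lra))).
    apply: open_ball_interior => //; have := HN s hs; rewrite /N /E.
    have := dot_self_ge0 (vsub (p s) (P s)); have := Rle_0_sqr (g s - mu); rewrite /Rsqr; lra.
  have Dq s : 0 <= s <= t -> forall i, deriv (fun r => q r i) s
      (eps * (p s i + g s * (a0 (q s) i + eps * a1 (q s) (phi s) i))).
    by move=> hs; case: (HF s ltac:(lra)).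
  pose om s := dot (a_eps a0 a1 eps (q s) (phi s)) (p s) + h_eps h0 h1 eps (q s) (phi s) * g s.
  have Dphi s : 0 <= s <= t -> deriv phi s (om s).
    by move=> hs; case: (HF s ltac:(lra)) => _ [].
  have Pa i := partials_add_scale eps (sj_partials (Ja0 i)) (j_partials (Ja1 i)).
  have Ph := partials_add_scale eps (sj_partials Jh0) (j_partials Jh1).
  have Pu := partials_add_scale eps (sj_partials Ju0) (j_partials Ju1).
  have Dp s : 0 <= s <= t -> forall j, deriv (fun r => p r j) s
      (- eps * pot (fun i => da0 i j (q s) + eps * fst (da1 i) j (q s) (phi s))
             (dh0 j (q s) + eps * fst dh1 j (q s) (phi s))
             (du0 j (q s) + eps * fst du1 j (q s) (phi s)) (p s) (g s)).
    move=> hs j; have [_ [_ [/(_ j) [L [HL DL]] _]]] := HF s ltac:(lra).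
    have Sq := interior_point_mem (HqS s hs).
    suff HL' : deriv (fun r => Kfull a0 a1 h0 U0 h1 U1 eps (upd (q s) j r) (phi s) (p s) (g s))
        (q s j) (pot (fun i => da0 i j (q s) + eps * fst (da1 i) j (q s) (phi s))
             (dh0 j (q s) + eps * fst dh1 j (q s) (phi s))
             (du0 j (q s) + eps * fst du1 j (q s) (phi s)) (p s) (g s)).
      by rewrite -(deriv_uniq HL HL').
    apply: (deriv_pot (A := fun r => a_eps a0 a1 eps (upd (q s) j r) (phi s))
      (h := fun r => h_eps h0 h1 eps (upd (q s) j r) (phi s))
      (u := fun r => U_eps U0 U1 eps (upd (q s) j r) (phi s))).
    - by move=> i; have [/(_ j)] := Pa i (q s) (phi s) Sq.
    - by have [/(_ j)] := Ph (q s) (phi s) Sq.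
    - by have [/(_ j)] := Pu (q s) (phi s) Sq.
  pose w s := pot (fun i => snd (da1 i) (q s) (phi s)) (snd dh1 (q s) (phi s))
    (snd du1 (q s) (phi s)) (p s) (g s).
  have Dg s : 0 <= s <= t -> deriv g s (- eps * w s).
    move=> hs; have [_ [_ [_ [L [HL]]]]] := HF s ltac:(lra).
    have Sq := interior_point_mem (HqS s hs).
    suff HL' : deriv (fun r => K1 a1 h1 U1 (q s) r (p s) (g s)) (phi s) (w s).
      by rewrite (deriv_uniq HL HL').
    apply: (deriv_pot (A := fun r => a1 (q s) r) (h := fun r => h1 (q s) r)
      (u := fun r => U1 (q s) r)).
    - by move=> i; have [] := j_partials (Ja1 i) (phi s) Sq.
    - by have [] := j_partials Jh1 (phi s) Sq.
    - by have [] := j_partials Ju1 (phi s) Sq.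
  have EF := energy_conserved Pa Ph Pu HqS Dq Dp Dphi Dg.
  (* The frequency [om] is both the rate of [phi] and the slope of the energy in [g], so the two
     terms cancel; the zeros are the [phi]-derivatives of the static data. *)
  have bal s : 0 <= s <= t -> - eps * w s * om s + om s * pot
      (fun i => 0 + eps * snd (da1 i) (q s) (phi s)) (0 + eps * snd dh1 (q s) (phi s))
      (0 + eps * snd du1 (q s) (phi s)) (p s) (g s) = 0.
    by move=> _; rewrite pot_add_scale pot0 /w; ring.
  apply: (HK S a0 h0 U0 a1 h1 U1 da0 dh0 du0 (fun i => fst (da1 i)) (fst dh1) (fst du1)
    (fun i => snd (da1 i)) (snd dh1) (snd du1) eps t mu Q P q p phi g) => //; try lra.
    by apply: eT; lra.
    by rewrite /G; lra.
  move=> s hs; have hs' : 0 <= s <= T by lra.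
  have hN := HN s hs; have pp := dot_self_ge0 (vsub (p s) (P s)).
  have qq := dot_self_ge0 (vsub (q s) (Q s)).
  have hg : Rabs (g s - mu) <= delta by apply: Rabs_le_of_sq; [lra|rewrite /N /E in hN; lra].
  have gG : Rabs (g s) <= Rabs mu + delta by split_Rabs; lra.
  have hp i : Rabs (p s i - P s i) <= delta.
    apply: Rabs_le_of_sq; first lra.
    have : (p s i - P s i) * (p s i - P s i) <= dot (vsub (p s) (P s)) (vsub (p s) (P s)).
      exact: (coord_sq_le_dot (vsub (p s) (P s)) i).
    have := Rle_0_sqr (g s - mu); rewrite /N /E in hN; rewrite /Rsqr; lra.
  have bP := PB s hs'.
  split; [split|split; [split=> //|split; [split|split]]].
  - exact: interior_point_mem (QS s hs').
  - exact: interior_point_mem (HqS s hs).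
  - move=> z hz; apply: (DS s) => //; have := dot_vsub_box hz; rewrite /N /E in hN.
    by have := Rle_0_sqr (g s - mu); rewrite /Rsqr; lra.
  - by move=> i; have := bP i; lra.
  - by move=> i; have := bP i; have := hp i; split_Rabs; lra.
  - exact: DQ.
  - exact: DP.
  - exact: Dq.
  - exact: Dp.
  - exact: EA.
  - exact: EF bal s hs.
  (* The midpoint in [g] only halves the action deviation, so it is still within delta of the
     averaged orbit and hence in [D]. *)
  - apply: (freq eps _ (q s) (phi s) (p s) ((g s + mu) / 2)); first lra.
    apply: (HD _ _ _ _ _ _ (HDd s hs')).
    rewrite /dist_qpg -(sqrt_square delta); last lra.
    rewrite dot_vsub_sym (dot_vsub_sym (P s)); apply: sqrt_lt_1_alt.
    have -> : (mu - (g s + mu) / 2) ^ 2 = (g s - mu) * (g s - mu) / 4 by field.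
    by have := Rle_0_sqr (g s - mu); rewrite /N /E in hN; rewrite /Rsqr; lra.
have NT : forall t, 0 <= t <= T -> N t < delta * delta.
  apply: continuity_induction.
  - by nra.
  - by rewrite /N /E Q0E P0E Hg0 !dot_vsub_self; nra.
  - move=> t ht; have [Dq [_ [Dp [Lg [_ Dg]]]]] := HF t ht.
    have [dp Hdp] := functional_choice Dp.
    have Dvq i : deriv (fun s => vsub (q s) (Q s) i) t _ := deriv_sub (Dq i) (DQ t ht i).
    have Dvp i : deriv (fun s => vsub (p s) (P s) i) t _ := deriv_sub (proj2 (Hdp i)) (DP t ht i).
    have Dgm := deriv_sub Dg (deriv_cst mu t).
    apply: deriv_continuity_pt; apply: deriv_add (deriv_mul Dgm Dgm).
    by apply: deriv_add; [exact: (deriv_dot Dvq Dvq)|exact: (deriv_dot Dvp Dvp)].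
  (* [N t <= 2 * (K * eps)^2 <= 2 * (delta / 2)^2], which is exactly half of [delta * delta]. *)
  - move=> t ht HN; have [h1' h2'] := main t ht HN; rewrite /N.
    have := Rabs_pos (g t - mu); have : 0 <= K * eps by apply: Rmult_le_pos; lra.
    have -> : (g t - mu) * (g t - mu) = Rabs (g t - mu) * Rabs (g t - mu).
      by split_Rabs; ring.
    set b := K * eps in Kd h1' h2' *; set a := Rabs _ in h2' *.
    by nra.
move=> t ht; have [HE Hg] := main t ht (fun s hs => NT s ltac:(lra)).
have Ke : 0 <= K * eps by apply: Rmult_le_pos; lra.
have pp := dot_self_ge0 (vsub (p t) (P t)); have qq := dot_self_ge0 (vsub (q t) (Q t)).
have vq : vnorm (vsub (q t) (Q t)) <= K * eps by apply: vnorm_le => //; rewrite /E in HE; lra.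
have vp : vnorm (vsub (p t) (P t)) <= K * eps by apply: vnorm_le => //; rewrite /E in HE; lra.
by lra.
Qed.
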